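(* Let $f,g$ be elements of Thompson's group $F$ such that $\{\pi(f),\pi(g)\}$ is a generating set of $\mathbb{Z}^2$. Then there is an element $\sigma\in F$ such that $\{f,g^\sigma\}$ is a generating set of $F$.
   Context: Thompson's group $F$ is the group (under composition) of all orientation-preserving piecewise-linear homeomorphisms of $[0,1]$ with finitely many breakpoints, all breakpoints being dyadic fractions (elements of $\mathbb{Z}[\frac12]\cap(0,1)$) and all slopes being integer powers of $2$. The standard abelianization map $\pi\colon F\to\mathbb{Z}^2$ is $\pi(f)=(\log_2 f'(0^+),\log_2 f'(1^-))$. Notation: $g^\sigma=\sigma^{-1}g\sigma$, with composition from left to right, i.e. $g^\sigma(t)=\sigma(g(\sigma^{-1}(t)))$. *)

(* Defs.v *)
From HB Require Import structures.
From mathcomp Require Import all_boot all_order all_algebra.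
From mathcomp Require Import all_classical all_reals all_analysis.
From mathcomp Require Import ring lra.

Set Implicit Arguments.
Unset Strict Implicit.
Unset Printing Implicit Defensive.

Import Order.TTheory GRing.Theory Num.Theory.
Import numFieldNormedType.Exports.

Local Open Scope classical_set_scope.
Local Open Scope ring_scope.

Definition generated_subgroup (G : groupType) (S : set G) : set G :=
  smallest (fun H : set G => group_closed [in H]) S.

Definition generates (G : groupType) (S : set G) : Prop :=
  generated_subgroup S = [set: G].

Section ThompsonF.
Variable R : realType.
Implicit Types (f g : R -> R) (s : seq R) (a b c x : R).

Definition homeomorphism f : Prop :=
  exists g, [/\ cancel f g, cancel g f, continuous f & continuous g].

Definition dyadic x : Prop := exists (m : int) (n : nat), x = m%:~R / 2 ^+ n.

(* f is affine, with slope an integer power of 2, on every closed subinterval of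
   [0, 1] whose interior does not meet s: f is piecewise linear on [0, 1] with
   all its breakpoints in s. *)
Definition pl_pow2 s f : Prop :=
  forall a b, 0 <= a -> a < b -> b <= 1 ->
    {in s, forall c, c \notin `]a, b[} ->
    exists k : int, {in `[a, b], forall x, f x = f a + 2 ^ k * (x - a)}.

(* A homeomorphism of [0, 1] preserving orientation fixes 0 and 1; it is encoded
   by its extension to R by the identity, so that Leibniz equality of elements
   is equality on [0, 1]. *)
Definition thompson_set : set (R -> R) := [set f |
  [/\ homeomorphism f,
      {homo f : x y / x < y},
      forall x, x \notin `]0, 1[ -> f x = x &
      exists2 s, {in s, forall c, (c \in `]0, 1[) /\ dyadic c} & pl_pow2 s f]].

Lemma dyadicD x y : dyadic x -> dyadic y -> dyadic (x + y).
Proof.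
move=> [m [p ->]] [n [q ->]].
exists (m * 2 ^+ q + n * 2 ^+ p), (p + q)%N.
have p0 : (2 : R) ^+ p != 0 by rewrite expf_neq0.
have q0 : (2 : R) ^+ q != 0 by rewrite expf_neq0.
rewrite rmorphD !rmorphM !rmorphXn /= exprD.
by rewrite invfM mulrDl mulrACA divff// mulr1 [(2 ^+ p)^-1 * _]mulrC mulrACA divff// mulr1.
Qed.

Lemma dyadicN x : dyadic x -> dyadic (- x).
Proof. by move=> [m [p ->]]; exists (- m), p; rewrite rmorphN mulNr. Qed.

Lemma dyadicM_pow2 (k : int) x : dyadic x -> dyadic (2 ^ k * x).
Proof.
move=> [m [p ->]]; case: k => n.
  by exists (2 ^+ n * m), p; rewrite rmorphM rmorphXn /= mulrA.
by exists m, (p + n.+1)%N; rewrite NegzE exprD invfM mulrCA [(2 ^+ p)^-1 * _]mulrC.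
Qed.

Lemma dyadic0 : dyadic 0.
Proof. by exists 0, 0%N; rewrite mul0r. Qed.

Lemma thompson_le f : {homo f : x y / x < y} -> {mono f : x y / x <= y}.
Proof. exact: le_mono. Qed.

Lemma thompson_lt f : {homo f : x y / x < y} -> {mono f : x y / x < y}.
Proof. by move=> /thompson_le fm; exact: leW_mono. Qed.

Lemma thompson_galois f g : {homo f : x y / x < y} -> cancel g f ->
  ((forall x y, (g x < y) = (x < f y)) * (forall x y, (y < g x) = (f y < x))) *
  ((forall x y, (g x <= y) = (x <= f y)) * (forall x y, (y <= g x) = (f y <= x))).
Proof.
move=> fm gf; split; split => x y;
  by rewrite -1?(thompson_lt fm) -1?(thompson_le fm) gf.
Qed.

Lemma thompson_ends f : thompson_set f -> f 0 = 0 /\ f 1 = 1.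
Proof. by move=> [_ _ f1 _]; split; apply: f1; rewrite in_itv /= ltxx ?andbF. Qed.

Lemma thompson_itv f x : thompson_set f -> (f x \in `]0, 1[) = (x \in `]0, 1[).
Proof.
move=> tf; have [f0 f1] := thompson_ends tf; case: tf => _ /thompson_lt fm _ _.
by rewrite !in_itv /= -[in LHS]f0 -[in LHS]f1 !fm.
Qed.

Lemma pl_dyadic s f : {in s, forall c, dyadic c} ->
  forall a b, a < b ->
  (forall x y, a <= x -> x < y -> y <= b -> {in s, forall c, c \notin `]x, y[} ->
    exists k : int, {in `[x, y], forall z, f z = f x + 2 ^ k * (z - x)}) ->
  dyadic a -> dyadic b -> dyadic (f a) -> dyadic (f b).
Proof.
elim: s => [|c s IH] ds a b ab pl da db dfa.
  have [//|k fk] := pl a b (lexx _) ab (lexx _).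
  rewrite fk; last by rewrite in_itv /= lexx ltW.
  by apply/dyadicD => //; apply/dyadicM_pow2/dyadicD => //; apply/dyadicN.
have dc : dyadic c by apply: ds; rewrite mem_head.
have ds' : {in s, forall c, dyadic c}.
  by move=> d ds0; apply: ds; rewrite in_cons ds0 orbT.
have [/andP[ac cb]|acb] := boolP (a < c < b).
  have dfc : dyadic (f c).
    apply: (IH ds' a c) => // x y ax xy yc sxy; apply: pl => //.
      exact: le_trans yc (ltW cb).
    move=> d; rewrite in_cons => /orP[/eqP ->|/sxy//].
    by rewrite in_itv /= negb_and -!leNgt yc orbT.
  apply: (IH ds' c b) => // x y cx xy yb sxy; apply: pl => //.
    exact: le_trans (ltW ac) cx.
  move=> d; rewrite in_cons => /orP[/eqP ->|/sxy//].
  by rewrite in_itv /= negb_and -!leNgt cx.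
apply: (IH ds' a b) => // x y ax xy yb sxy; apply: pl => //.
move=> d; rewrite in_cons => /orP[/eqP ->|/sxy//].
apply: contra acb; rewrite in_itv /= => /andP[xc cy].
by rewrite (le_lt_trans ax xc) (lt_le_trans cy yb).
Qed.

Lemma thompson_dyadic f x : thompson_set f -> x \in `]0, 1[ -> dyadic x ->
  dyadic (f x).
Proof.
move=> tf; have [f0 f1] := thompson_ends tf; case: tf => _ _ _ [s ds pl].
rewrite in_itv /= => /andP[x0 x1] dx.
apply: (@pl_dyadic s f _ 0 x) => //.
- by move=> c /ds[].
- by move=> y z y0 yz zx; apply: pl => //; exact: le_trans zx (ltW x1).
- exact: dyadic0.
- by rewrite f0; exact: dyadic0.
Qed.

Lemma thompson_id : thompson_set id.
Proof.
split => //; first by exists id; split => // x; exact: cvg_id.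
exists [::] => // a b _ _ _ _; exists 0 => x _.
by rewrite expr0z mul1r addrC subrK.
Qed.

Lemma thompson_inv f g : cancel f g -> cancel g f -> thompson_set f ->
  thompson_set g.
Proof.
move=> fg gf tf; have [f0 f1] := thompson_ends tf.
have fi x := thompson_itv x tf.
have fd x := @thompson_dyadic f x tf.
case: tf => -[g' [fg' g'f cf cg']] fm fx [s ds pl].
have g'E : g' = g by apply/funext => x; rewrite -{1}(gf x) fg'.
rewrite {}g'E {fg' g'f g'} in cg'.
have gm : {mono g : x y / x < y}.
  by move=> x y; rewrite -(thompson_lt fm) !gf.
split.
- by exists f; split.
- by move=> x y; rewrite gm.
- move=> x x01; rewrite -{1}[x]fx ?fg//.
exists (map f s).
  by move=> _ /mapP[c /ds[c01 dc] ->]; split; [rewrite fi | exact: fd].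
move=> a b a0 ab b1 sab.
have [] := pl (g a) (g b).
- by rewrite -(thompson_le fm) gf f0.
- by rewrite gm.
- by rewrite -(thompson_le fm) gf f1.
- move=> c cs; have := sab (f c) (map_f _ cs).
  by apply: contra; rewrite !in_itv /= !(thompson_galois fm gf).
move=> k fk; exists (- k) => x /andP[ax xb].
have gx1 : g a <= g x by rewrite (thompson_galois fm gf) gf.
have gx2 : g x <= g b by rewrite (thompson_galois fm gf) gf.
have {}fk := fk (g x).
rewrite -[X in X - a]gf fk; last first.
  by rewrite in_itv /= gx1 gx2.
rewrite gf addrAC subrr add0r mulrA -expfzDr ?pnatr_eq0//.
by rewrite addNr expr0z mul1r addrC subrK.
Qed.

Lemma thompson_comp f g : thompson_set f -> thompson_set g ->
  thompson_set (g \o f).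
Proof.
move=> tf tg; have [f0 f1] := thompson_ends tf.
have fi x := thompson_itv x tf.
have [[f' [ff' f'f cf cf']] fm fx [s ds pl]] := tf.
have tf' := thompson_inv ff' f'f tf.
have [[g' [gg' g'g cg cg']] gm gx [t dt plg]] := tg.
split.
- exists (f' \o g'); split.
  + exact: can_comp.
  + exact: can_comp.
  + by move=> x; apply: continuous_comp; [exact: cf | exact: cg].
  + by move=> x; apply: continuous_comp; [exact: cg' | exact: cf'].
- by move=> x y xy /=; apply/gm/fm.
- by move=> x x01 /=; rewrite fx// gx.
exists (s ++ map f' t).
  move=> c; rewrite mem_cat => /orP[/ds//|/mapP[d /dt[d01 dd] ->]].
  by split; [rewrite (thompson_itv _ tf') | exact: thompson_dyadic].
move=> a b a0 ab b1 sab.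
have [//|k fk] := pl a b a0 ab b1.
  by move=> c cs; apply: sab; rewrite mem_cat cs.
have [] := plg (f a) (f b).
- by rewrite -f0 (thompson_le fm).
- exact: fm.
- by rewrite -f1 (thompson_le fm).
- move=> c ct; have := sab (f' c).
  rewrite mem_cat map_f ?orbT// => /(_ isT).
  by apply: contra; rewrite !in_itv /= !(thompson_galois fm f'f).
move=> l gl; exists (l + k) => x xab /=.
rewrite gl.
  by rewrite (fk _ xab) addrAC subrr add0r mulrA expfzDr// pnatr_eq0.
by move: xab; rewrite !in_itv /= !(thompson_le fm).
Qed.

Definition thompsonF : Type := thompson_set.

HB.instance Definition _ := Choice.on thompsonF.

Definition fun_of_thompsonF (f : thompsonF) : R -> R := val f.
Coercion fun_of_thompsonF : thompsonF >-> Funclass.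

Lemma thompsonFP (f : thompsonF) : thompson_set f.
Proof. by apply/set_mem/(valP f). Qed.

Lemma thompsonF_inj (f g : thompsonF) : f =1 g -> f = g.
Proof. by move=> fg; apply/val_inj/funext. Qed.

Definition thompsonF_one : thompsonF := exist _ id (mem_set thompson_id).

(* composition from left to right *)
Definition thompsonF_mul (f g : thompsonF) : thompsonF :=
  exist _ (g \o f) (mem_set (thompson_comp (thompsonFP f) (thompsonFP g))).

Lemma thompsonF_inv_ex (f : thompsonF) :
  exists g : thompsonF, cancel f g /\ cancel g f.
Proof.
have [[g [fg gf _ _]] _ _ _] := thompsonFP f.
by exists (exist _ g (mem_set (thompson_inv fg gf (thompsonFP f)))); split.
Qed.

Definition thompsonF_inv (f : thompsonF) : thompsonF :=
  sval (cid (thompsonF_inv_ex f)).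

Lemma thompsonF_mulA : associative thompsonF_mul.
Proof. by move=> f g h; apply: thompsonF_inj. Qed.

Lemma thompsonF_mul1 : left_id thompsonF_one thompsonF_mul.
Proof. by move=> f; apply: thompsonF_inj. Qed.

Lemma thompsonF_mulr1 : right_id thompsonF_one thompsonF_mul.
Proof. by move=> f; apply: thompsonF_inj. Qed.

Lemma thompsonF_mulV : left_inverse thompsonF_one thompsonF_inv thompsonF_mul.
Proof.
move=> f; apply: thompsonF_inj => x.
by rewrite /thompsonF_inv; case: cid => g [fg gf] /=; exact: gf.
Qed.

Lemma thompsonF_mulrV : right_inverse thompsonF_one thompsonF_inv thompsonF_mul.
Proof.
move=> f; apply: thompsonF_inj => x.
by rewrite /thompsonF_inv; case: cid => g [fg gf] /=; exact: fg.
Qed.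

HB.instance Definition _ := isGroup.Build thompsonF thompsonF_mulA
  thompsonF_mul1 thompsonF_mulr1 thompsonF_mulV thompsonF_mulrV.

Lemma thompsonF_conjgE (g h : thompsonF) (t : R) :
  (g ^ h : thompsonF)%g t = h (g ((h^-1 : thompsonF)%g t)).
Proof. by []. Qed.

Definition right_derivative f a : R :=
  lim ((f (a + h) - f a) / h @[h --> 0^'+]).

Definition left_derivative f a : R :=
  lim ((f (a + h) - f a) / h @[h --> 0^'-]).

Definition log2 x : R := ln x / ln 2.

(* Num.floor only converts the two real logarithms, which are integers by
   thompson_abE below, to type int. *)
Definition thompson_ab (f : thompsonF) : int * int :=
  (Num.floor (log2 (right_derivative f 0)),
   Num.floor (log2 (left_derivative f 1))).

Lemma log2_pow2 (k : int) : log2 (2 ^ k) = k%:~R.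
Proof.
have l2 : ln (2 : R) != 0 by rewrite gt_eqF// ln_gt0// ltr1n.
rewrite /log2; case: k => n.
  by rewrite -exprnP lnXn// -(mulr_natl (ln 2)) mulfK// pmulrn.
by rewrite NegzE -exprnN lnV ?posrE ?exprn_gt0// lnXn// -(mulr_natl (ln 2)) mulNr mulfK//.
Qed.

Lemma seq_gap s (x : R) : exists2 d : R, 0 < d <= 1 &
  {in s, forall c, (c \notin `]x, x + d[) /\ (c \notin `]x - d, x[)}.
Proof.
elim: s => [|c s [d /andP[d0 d1] sd]]; first by exists 1; rewrite ?ltr01 ?lexx.
have [->|cx] := eqVneq c x.
  exists d; first by rewrite d0.
  move=> y; rewrite in_cons => /orP[/eqP ->|/sd//].
  by rewrite !in_itv /= !ltxx andbF.
have cx0 : 0 < `|c - x| by rewrite normr_gt0 subr_eq0.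
pose e := Num.min d `|c - x|.
have ed : e <= d by rewrite /e ge_min lexx.
have ec : e <= `|c - x| by rewrite /e ge_min lexx orbT.
exists e; first by rewrite /e lt_min d0 cx0 (le_trans ed d1).
move=> y; rewrite in_cons => /orP[/eqP ->|/sd[]]; last first.
  by rewrite !in_itv /= => ys1 ys2; split;
    [apply: contra ys1 | apply: contra ys2] => /andP[? ?]; apply/andP; split; lra.
rewrite !in_itv /=; split; apply/negP => /andP[h1 h2].
  by move: ec; rewrite ger0_norm; lra.
by move: ec; rewrite ltr0_norm; lra.
Qed.

Lemma right_slope f (m d : R) : 0 < d ->
  (forall h, 0 < h < d -> f h = f 0 + m * h) -> right_derivative f 0 = m.
Proof.
move=> d0 fm; apply: cvg_lim => //; apply: cvg_near_cst.
near=> h.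
have h0 : 0 < h by [].
rewrite add0r fm; first by rewrite addrAC subrr add0r mulfK// gt_eqF.
by rewrite h0 /=; near: h; exact: nbhs_right_lt.
Unshelve. all: by end_near. Qed.

Lemma left_slope f (m d : R) : 0 < d ->
  (forall h, - d < h < 0 -> f (1 + h) = f 1 + m * h) -> left_derivative f 1 = m.
Proof.
move=> d0 fm; apply: cvg_lim => //; apply: cvg_near_cst.
near=> h.
have h0 : h < 0 by [].
rewrite fm; first by rewrite addrAC subrr add0r mulfK// lt_eqF.
rewrite h0 andbT; near: h; apply: nbhs_left_gt; lra.
Unshelve. all: by end_near. Qed.

Lemma thompson_abE (f : thompsonF) :
  right_derivative f 0 = 2 ^ (thompson_ab f).1 /\
  left_derivative f 1 = 2 ^ (thompson_ab f).2.
Proof.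
have [_ _ _ [s _ pl]] := thompsonFP f.
split.
  have [d /andP[d0 d1] sd] := seq_gap s 0.
  have [|k fk] := pl 0 d (lexx _) d0 d1.
    by move=> c /sd[+ _]; rewrite add0r.
  have fk' : right_derivative f 0 = 2 ^ k.
    apply: (right_slope d0) => h /andP[h0 hd].
    by rewrite fk ?subr0// in_itv /= !ltW.
  by rewrite /thompson_ab /= fk' log2_pow2 intrKfloor.
have [d /andP[d0 d1] sd] := seq_gap s 1.
have [||||k fk] := pl (1 - d) 1 => //; [lra|lra|by move=> c /sd[]|].
have fk' : left_derivative f 1 = 2 ^ k.
  apply: (left_slope d0) => h /andP[h0 hd].
  rewrite [f (1 + h)]fk; last by rewrite in_itv /=; apply/andP; split; lra.
  rewrite [f 1]fk; last by rewrite in_itv /=; apply/andP; split; lra.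
  by ring.
by rewrite /thompson_ab /= fk' log2_pow2 intrKfloor.
Qed.

End ThompsonF.

(* Main.v *)
Require Import Defs.
From HB Require Import structures.
From mathcomp Require Import all_boot all_order all_algebra.
From mathcomp Require Import all_classical all_reals all_analysis.
From mathcomp Require Import ring lra zify.

(* Replacing f and g by conjugates f^s1 and g^s2 is allowed, since conjugating
   the pair by s1^-1 only conjugates g. The determinant of (pi f, pi g) being
   nonzero, up to exchanging f and g, f is not the identity near 0 and g is not
   the identity near 1.
   If f coincides near 0 with phi, and phi moves every point of ]0, 1[ to the
   right, then f^(phi^n) coincides with phi on [0, B] for n large: up to
   conjugacy, f and g can be prescribed arbitrarily on [0, B], except for their
   first germs. The prescription is chosen such that the subgroup H generated by
   the conjugates
   - has an element h trivial on [0, d] and pushing points to the left after d,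
     which together with the expanding map f and with the absence of fixed
     points of g near 1 lets H contract any compact subset of ]0, 1[ into a
     fixed interval ]a, b[;
   - induces on [a, b] the whole group F_[a, b] of maps supported in [a, b],
     because f^-1 g and g f^-1 induce on [a, b] a generating pair of it.
   A commutator of elements of H is supported inside ]0, 1[, so it can be
   contracted to a nontrivial element n of H supported in [a, b]; n moves some
   interval J off itself, and [[n, u], v] = [u, v] for u and v supported in J.
   Hence H contains the derived subgroup of F_J, thus every element supported
   inside J, thus by contraction every element supported inside ]0, 1[, that
   is, the kernel of pi. As pi maps H onto Z^2, H is the whole group. *)

Set Implicit Arguments.
Unset Strict Implicit.
Unset Printing Implicit Defensive.

Import Order.TTheory GRing.Theory Num.Theory.
Import numFieldNormedType.Exports.

Local Open Scope classical_set_scope.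
Local Open Scope ring_scope.

(** * Piecewise linear maps of the line *)

Section PiecewiseLinear.
Variable R : realType.
Implicit Types (f g : R -> R) (a b c d p x y : R).

Definition paste p f g : R -> R := fun x => if x <= p then f x else g x.

(** Maps of the whole line rather than of [0, 1]: affine maps and maps carrying [0, 1] onto a
    smaller interval then belong to the same group and can serve as conjugators. The inductive form
    lets closure properties be proved gluing by gluing. *)
Inductive pl2 : (R -> R) -> Prop :=
| pl2_affine (k : int) d : dyadic d -> pl2 (fun x => 2 ^ k * x + d)
| pl2_paste f g p : dyadic p -> f p = g p -> pl2 f -> pl2 g ->
    pl2 (paste p f g).

Lemma pow2_gt0 (k : int) : 0 < 2 ^ k :> R.
Proof. by rewrite exprz_gt0. Qed.

Lemma pow2_ge2 (k : int) : 0 < k -> 2 <= 2 ^ k :> R.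
Proof.
case: k => [[|n]|n]// _; rewrite -exprnP exprS ler_peMr// exprn_ege1//.
by rewrite ler1n.
Qed.

Lemma pasteL p f g x : x <= p -> paste p f g x = f x.
Proof. by rewrite /paste => ->. Qed.

Lemma pasteR p f g x : f p = g p -> p <= x -> paste p f g x = g x.
Proof.
move=> fg px; rewrite /paste; case: ifP => // xp.
by have -> : x = p by apply/le_anti; rewrite xp px.
Qed.

Lemma pl2_lt f : pl2 f -> {homo f : x y / x < y}.
Proof.
elim=> [k d _ x y xy|{}f g p _ fg _ fm _ gm x y xy].
  by rewrite ltrD2r ltr_pM2l// pow2_gt0.
rewrite /paste; have [xp|px] := leP x p; have [yp|py] := leP y p.
- exact: fm.
- case: (ltgtP x p) xp => // [xp _|-> _]; last by rewrite fg; exact: gm.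
  by rewrite (lt_trans (fm _ _ xp))// fg gm.
- lra.
- exact: gm.
Qed.

Lemma pl2_dyadic f x : pl2 f -> dyadic x -> dyadic (f x).
Proof.
elim=> [k d dd dx|{}f g p _ _ _ IHf _ IHg dx].
  by apply: dyadicD => //; exact: dyadicM_pow2.
by rewrite /paste; case: ifP => _; [exact: IHf|exact: IHg].
Qed.

Lemma pl2_inv f : pl2 f -> exists g, [/\ pl2 g, cancel f g & cancel g f].
Proof.
elim=> [k d dd|{}f g p dp fg pf [f' [pf' ff' f'f]] pg [g' [pg' gg' g'g]]].
  exists (fun x => 2 ^ (- k) * x + - (2 ^ (- k) * d)); split.
  - by apply/pl2_affine/dyadicN/dyadicM_pow2.
  - move=> x; rewrite mulrDr mulrA -expfzDr ?pnatr_eq0// addNr expr0z mul1r.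
    by rewrite addrK.
  - move=> x; rewrite mulrDr mulrN !mulrA -expfzDr ?pnatr_eq0// addrN expr0z.
    by rewrite !mul1r subrK.
have fm := thompson_le (pl2_lt pf); have gm := thompson_le (pl2_lt pg).
exists (paste (f p) f' g'); split.
- apply: pl2_paste => //; first exact: pl2_dyadic.
  by rewrite ff' fg gg'.
- move=> x; rewrite /paste; have [xp|px] := leP x p; first by rewrite fm xp ff'.
  by rewrite fg gm leNgt px /= gg'.
- move=> x; rewrite /paste; have [xp|px] := leP x (f p).
    by rewrite -fm f'f xp.
  by rewrite -gm g'g -fg leNgt px.
Qed.

(** Induction on [f], then, when [f] is affine, on [g], whose gluing points are pulled back by
    [f]. *)
Lemma pl2_comp f g : pl2 f -> pl2 g -> pl2 (g \o f).
Proof.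
move=> pf; elim: pf g => [k d dd|f1 f2 p dp f12 p1 IH1 p2 IH2] g pg; last first.
  rewrite [_ \o _](_ : _ = paste p (g \o f1) (g \o f2)).
    by apply: pl2_paste => //=; [rewrite f12|exact: IH1|exact: IH2].
  by apply/funext => x; rewrite /paste /=; case: ifP.
have [f' [pf' ff' f'f]] := pl2_inv (pl2_affine k dd).
elim: pg => [l e de|g1 g2 p dp g12 p1 IH1 p2 IH2].
  rewrite [_ \o _](_ : _ = fun x => 2 ^ (l + k) * x + (2 ^ l * d + e)).
    by apply/pl2_affine/dyadicD => //; exact: dyadicM_pow2.
  by apply/funext => x /=; rewrite expfzDr ?pnatr_eq0// mulrDr mulrA addrA.
rewrite [_ \o _](_ : _ = paste (f' p) (g1 \o (fun x => 2 ^ k * x + d))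
                                 (g2 \o (fun x => 2 ^ k * x + d))).
  apply: pl2_paste => //; first exact: pl2_dyadic.
  by move: (f'f p) => /= ->.
apply/funext => x; rewrite /paste /=.
suff -> : (x <= f' p) = (2 ^ k * x + d <= p) by [].
by rewrite -(thompson_le (pl2_lt (pl2_affine k dd))) f'f.
Qed.

Lemma pl2_id : pl2 id.
Proof.
rewrite [id](_ : _ = fun x => 2 ^ 0 * x + 0); first exact/pl2_affine/dyadic0.
by apply/funext => x; rewrite expr0z mul1r addr0.
Qed.

Lemma pl2_right f x : pl2 f -> exists (k : int) (e : R), 0 < e /\
  forall y, x <= y <= x + e -> f y = f x + 2 ^ k * (y - x).
Proof.
elim=> [k d _|{}f g p _ fg _ [k [e [e0 fe]]] _ [l [e' [e'0 ge]]]].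
  by exists k, 1; split => // y _; ring.
have [xp|px] := ltP x p.
  exists k, (Num.min e (p - x)); split; first by rewrite lt_min e0; lra.
  move=> y /andP[xy]; rewrite -lerBlDl le_min => /andP[ye yp].
  by rewrite !pasteL; [apply: fe; lra|lra|lra].
exists l, e'; split => // y /andP[xy ye].
by rewrite !(pasteR fg); [apply: ge; rewrite xy|lra|lra].
Qed.

Lemma pl2_left f x : pl2 f -> exists (k : int) (e : R), 0 < e /\
  forall y, x - e <= y <= x -> f y = f x + 2 ^ k * (y - x).
Proof.
elim=> [k d _|{}f g p _ fg _ [k [e [e0 fe]]] _ [l [e' [e'0 ge]]]].
  by exists k, 1; split => // y _; ring.
have [px|xp] := ltP p x.
  exists l, (Num.min e' (x - p)); split; first by rewrite lt_min e'0; lra.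
  move=> y /andP[+ yx]; rewrite lerBlDr -lerBlDl le_min => /andP[ye yp].
  by rewrite !(pasteR fg); [apply: ge; lra|lra|lra].
exists k, e; split => // y /andP[xy ye].
by rewrite !pasteL; [apply: fe; rewrite xy|lra|lra].
Qed.

Lemma pl2_continuous f : pl2 f -> continuous f.
Proof.
move=> pf x; have [k [e [e0 fr]]] := pl2_right x pf.
have [l [e' [e'0 fl]]] := pl2_left x pf.
apply/left_right_continuousP; split.
  have : (fun y => f x + 2 ^ l * (y - x)) y @[y --> x^'-] --> f x.
    rewrite -[X in _ --> X]addr0; apply: cvgD; first exact: cvg_cst.
    rewrite -(mulr0 (2 ^ l)); apply: cvgM; first exact: cvg_cst.
    rewrite -(subrr x); apply: cvgB; last exact: cvg_cst.
    exact: cvg_at_left_filter.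
  apply: cvg_trans; apply: near_eq_cvg; near=> y.
  rewrite (fl y)//; apply/andP; split; last by apply: ltW.
  by apply: ltW; near: y; apply: nbhs_left_gt; lra.
have : (fun y => f x + 2 ^ k * (y - x)) y @[y --> x^'+] --> f x.
  rewrite -[X in _ --> X]addr0; apply: cvgD; first exact: cvg_cst.
  rewrite -(mulr0 (2 ^ k)); apply: cvgM; first exact: cvg_cst.
  rewrite -(subrr x); apply: cvgB; last exact: cvg_cst.
  exact: cvg_at_right_filter.
apply: cvg_trans; apply: near_eq_cvg; near=> y.
rewrite (fr y)//; apply/andP; split; first by apply: ltW.
by apply: ltW; near: y; apply: nbhs_right_lt; lra.
Unshelve. all: by end_near. Qed.

Lemma pl2_breakpoints f : pl2 f -> exists2 s : seq R, {in s, forall c,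
  dyadic c} &
  forall a b, a < b -> {in s, forall c, c \notin `]a, b[} ->
    exists k : int, {in `[a, b], forall x, f x = f a + 2 ^ k * (x - a)}.
Proof.
elim=> [k d _|{}f g p dp fg _ [s ds fs] _ [t dt gt]].
  by exists [::] => // a b _ _; exists k => x _; ring.
exists (p :: s ++ t).
  by move=> c; rewrite inE mem_cat => /predU1P[->//|/orP[/ds|/dt]].
move=> a b ab st.
have pab : p \notin `]a, b[ by apply: st; rewrite mem_head.
have [k fk] : exists k : int, {in `[a, b], forall x,
  f x = f a + 2 ^ k * (x - a)}.
  by apply: fs => // c cs; apply: st; rewrite inE mem_cat cs orbT.
have [l gl] : exists k : int, {in `[a, b], forall x,
  g x = g a + 2 ^ k * (x - a)}.
  by apply: gt => // c cs; apply: st; rewrite inE mem_cat cs !orbT.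
have [bp|pb] := leP b p.
  exists k => x xab; rewrite !pasteL; [exact: fk|lra|].
  by move: xab; rewrite in_itv /=; lra.
have pa : p <= a.
  by move: pab; rewrite in_itv /= negb_and -!leNgt => /orP[//|]; lra.
exists l => x xab; rewrite !(pasteR fg); [exact: gl|lra|].
by move: xab; rewrite in_itv /=; lra.
Qed.

(** Cutting at the points of [s] inside ]a, b[ leaves affine pieces to be glued; the dyadic value at
    the left end is carried along because it makes the constant of each piece dyadic. *)
Lemma pl2_extend (s : seq R) f : {in s, forall c, dyadic c} ->
  forall a b, a < b ->
  (forall x y, a <= x -> x < y -> y <= b -> {in s, forall c, c \notin `]x,
    y[} ->
    exists k : int, {in `[x, y], forall z, f z = f x + 2 ^ k * (z - x)}) ->
  dyadic a -> dyadic (f a) -> exists2 g, pl2 g & {in `[a, b], f =1 g}.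
Proof.
elim: s => [|c s IH] ds a b ab pl da dfa.
  have [//|k fk] := pl a b (lexx _) ab (lexx _).
  exists (fun x => 2 ^ k * x + (f a - 2 ^ k * a)).
    by apply/pl2_affine/dyadicD => //; apply/dyadicN/dyadicM_pow2.
  by move=> x xab; rewrite fk//; ring.
have dc : dyadic c by apply: ds; rewrite mem_head.
have {}ds : {in s, forall d, dyadic d}.
  by move=> d ds0; apply: ds; rewrite in_cons ds0 orbT.
have [/andP[ac cb]|acb] := boolP (a < c < b); last first.
  apply: (IH ds a b) => // x y ax xy yb sxy; apply: pl => //.
  move=> d; rewrite in_cons => /orP[/eqP ->|/sxy//].
  apply: contra acb; rewrite in_itv /= => /andP[xc cy].
  by rewrite (le_lt_trans ax xc) (lt_le_trans cy yb).
have plc x y : a <= x -> x < y -> y <= c -> {in s, forall c, c \notin `]x,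
  y[} ->
    exists k : int, {in `[x, y], forall z, f z = f x + 2 ^ k * (z - x)}.
  move=> ax xy yc sxy; apply: pl => //; first exact: le_trans yc (ltW cb).
  move=> d; rewrite in_cons => /orP[/eqP ->|/sxy//].
  by rewrite in_itv /= negb_and -!leNgt yc orbT.
have [g pg fg] := IH ds a c ac plc da dfa.
have dfc : dyadic (f c).
  by rewrite fg ?in_itv /= ?lexx ?(ltW ac)//; exact: pl2_dyadic.
have [|h ph fh] := IH ds c b cb _ dc dfc.
  move=> x y cx xy yb sxy; apply: pl => //; first exact: le_trans (ltW ac) cx.
  move=> d; rewrite in_cons => /orP[/eqP ->|/sxy//].
  by rewrite in_itv /= negb_and -!leNgt cx.
exists (paste c g h).
  by apply: pl2_paste => //; rewrite -fg -?fh ?in_itv /= ?lexx ?(ltW ac) ?(ltW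
    cb).
move=> x; rewrite in_itv /paste /= => /andP[ax xb]; case: leP => xc.
  by rewrite fg// in_itv /= ax.
by rewrite fh// in_itv /= (ltW xc).
Qed.

Lemma dyadic1 : dyadic (1 : R).
Proof. by exists 1, 0%N; rewrite divr1. Qed.

Lemma thompson_pl2 f : thompson_set f -> pl2 f.
Proof.
move=> tf; have [f0 f1] := thompson_ends tf; case: tf => _ _ fx [s ds pl].
have [|||||g pg fg] := @pl2_extend s f _ 0 1.
- by move=> c /ds[].
- exact: ltr01.
- exact: pl.
- exact: dyadic0.
- by rewrite f0; exact: dyadic0.
rewrite (_ : f = paste 0 id (paste 1 g id)).
  have g0 : g 0 = 0 by rewrite -fg// in_itv /= lexx ler01.
  have g1 : g 1 = 1 by rewrite -fg// in_itv /= lexx ler01.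
  apply: pl2_paste; [exact: dyadic0| |exact: pl2_id|].
    by rewrite pasteL ?ler01.
  exact: pl2_paste dyadic1 g1 pg pl2_id.
apply/funext => x; rewrite /paste; case: leP => x0.
  by rewrite fx// in_itv /= ltNge x0.
case: leP => x1; first by rewrite fg// in_itv /= (ltW x0).
by rewrite fx// in_itv /= (ltNge x 1) (ltW x1) andbF.
Qed.

Lemma pl2_thompson f : pl2 f -> (forall x, x \notin `]0, 1[ -> f x = x) ->
  thompson_set f.
Proof.
move=> pf fx; have [g [pg fg gf]] := pl2_inv pf; split => //.
- by exists g; split => //; exact: pl2_continuous.
- exact: pl2_lt.
have [s ds pl] := pl2_breakpoints pf.
exists [seq c <- s | c \in `]0, 1[].
  by move=> c; rewrite mem_filter => /andP[? /ds].
move=> a b a0 ab b1 sab; apply: pl => // c cs.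
apply/negP => cab; have := sab c; rewrite mem_filter cs cab andbT.
suff -> : c \in `]0, 1[ by move=> /(_ isT).
by move: cab; rewrite !in_itv /=; lra.
Qed.

End PiecewiseLinear.

(** * The group of piecewise linear maps *)

Section PLGroup.
Variable R : realType.

Definition pl2_set : set (R -> R) := [set f | pl2 f].

Definition plG : Type := pl2_set.

HB.instance Definition _ := Choice.on plG.

Definition ap (f : plG) : R -> R := val f.
Coercion ap : plG >-> Funclass.
Arguments ap f%_g x.

Definition PlG (f : R -> R) (pf : pl2 f) : plG := exist _ f (mem_set pf).

Implicit Types (f g h u v : plG) (a b c d p x y : R).

Lemma plGP f : pl2 f.
Proof. by apply/set_mem/(valP f). Qed.

Lemma plG_inj f g : f =1 g -> f = g.
Proof. by move=> fg; apply/val_inj/funext. Qed.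

Definition plG_one : plG := PlG (pl2_id R).

(* composition from left to right *)
Definition plG_mul f g : plG := PlG (pl2_comp (plGP f) (plGP g)).

Lemma plG_inv_ex f : exists g : plG, cancel f g /\ cancel g f.
Proof. by have [g [pg fg gf]] := pl2_inv (plGP f); exists (PlG pg); split. Qed.

Definition plG_inv f : plG := sval (cid (plG_inv_ex f)).

Lemma plG_invK f : cancel f (plG_inv f).
Proof. by rewrite /plG_inv; case: cid => g []. Qed.

Lemma plG_invVK f : cancel (plG_inv f) f.
Proof. by rewrite /plG_inv; case: cid => g []. Qed.

Lemma plG_mulA : associative plG_mul.
Proof. by move=> f g h; apply: plG_inj. Qed.

Lemma plG_mul1 : left_id plG_one plG_mul.
Proof. by move=> f; apply: plG_inj. Qed.

Lemma plG_mulr1 : right_id plG_one plG_mul.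
Proof. by move=> f; apply: plG_inj. Qed.

Lemma plG_mulV : left_inverse plG_one plG_inv plG_mul.
Proof. by move=> f; apply: plG_inj => x; exact: plG_invVK. Qed.

Lemma plG_mulrV : right_inverse plG_one plG_inv plG_mul.
Proof. by move=> f; apply: plG_inj => x; exact: plG_invK. Qed.

HB.instance Definition _ := isGroup.Build plG plG_mulA
  plG_mul1 plG_mulr1 plG_mulV plG_mulrV.

Lemma plG1E x : ap 1 x = x. Proof. by []. Qed.

Lemma plGME f g x : ap (f * g) x = g (f x). Proof. by []. Qed.

Lemma plGK f : cancel f (ap f^-1). Proof. exact: plG_invK. Qed.

Lemma plGVK f : cancel (ap f^-1) f. Proof. exact: plG_invVK. Qed.

Lemma plGJE f g x : ap (f ^ g) x = g (f (ap g^-1 x)).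
Proof. by rewrite conjgE !plGME. Qed.

Lemma plGJ f g x : ap (f ^ g) (g x) = g (f x).
Proof. by rewrite plGJE plGK. Qed.

Lemma plGXS f n x : ap (f ^+ n.+1) x = f (ap (f ^+ n) x).
Proof. by rewrite expgSr. Qed.

Lemma plGXSr f n x : ap (f ^+ n.+1) x = ap (f ^+ n) (f x).
Proof. by rewrite expgS. Qed.

Lemma plG_lt f : {mono f : x y / x < y}.
Proof. exact: thompson_lt (pl2_lt (plGP f)). Qed.

Lemma plG_le f : {mono f : x y / x <= y}.
Proof. exact: thompson_le (pl2_lt (plGP f)). Qed.

Lemma plG_injE f x y : f x = f y -> x = y.
Proof. exact: can_inj (plGK f) _ _. Qed.

Lemma plG_ltV f x y : (ap f^-1 x < y) = (x < f y).
Proof. by rewrite -(plG_lt f) plGVK. Qed.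

Lemma plG_gtV f x y : (y < ap f^-1 x) = (f y < x).
Proof. by rewrite -(plG_lt f) plGVK. Qed.

Lemma plG_leV f x y : (ap f^-1 x <= y) = (x <= f y).
Proof. by rewrite -(plG_le f) plGVK. Qed.

Lemma plG_geV f x y : (y <= ap f^-1 x) = (f y <= x).
Proof. by rewrite -(plG_le f) plGVK. Qed.

Lemma plG_dyadic f x : dyadic x -> dyadic (f x).
Proof. exact/pl2_dyadic/plGP. Qed.

Lemma plG_cont f : continuous f.
Proof. exact/pl2_continuous/plGP. Qed.

Lemma plG_eqV f x : f x = x -> ap f^-1 x = x.
Proof. by move=> fx; rewrite -[in LHS]fx plGK. Qed.

Lemma plG_iter_fix f n x : f x = x -> ap (f ^+ n) x = x.
Proof. by move=> fx; elim: n => // n IH; rewrite plGXS IH. Qed.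

(** By compactness x - f x has a positive minimum on [e, y], and each iterate still in this interval
    descends by at least that much. *)
Lemma plG_drift f e y : (forall x, e <= x <= y -> f x < x) ->
  exists n, ap (f ^+ n) y < e.
Proof.
move=> fx; have [ye|ey] := ltP y e; first by exists 0%N.
have cf : {within `[e, y], continuous (fun x => x - f x)}.
  apply: continuous_subspaceT => x; apply: cvgB; first exact: cvg_id.
  exact: plG_cont.
have [c] := EVT_min ey cf; rewrite in_itv /= => cey cmin.
have m0 : 0 < c - f c by rewrite subr_gt0 fx.
apply: contrapT => nex.
have step n : e <= ap (f ^+ n) y <= y - (c - f c) *+ n.
  apply/andP; split; first by rewrite leNgt; apply/negP => ?; apply: nex;
    exists n.
  elim: n => [|n IH]; first by rewrite mulr0n subr0.
  rewrite plGXS; set z := ap (f ^+ n) y in IH *.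
  have ez : e <= z by rewrite leNgt; apply/negP => ?; apply: nex; exists n.
  have zy : z <= y by apply: le_trans IH _; rewrite gerBl mulrn_wge0// ltW.
  have := cmin z; rewrite in_itv /= ez zy => /(_ isT) mz.
  by rewrite mulrSr; lra.
have [n nb] : exists n : nat, (y - e) / (c - f c) < n%:R.
  by exists (Num.bound ((y - e) / (c - f c))); rewrite archi_boundP// divr_ge0;
    lra.
have /andP[h1] := step n.
by move: nb; rewrite ltr_pdivrMr// mulr_natl => h2; lra.
Qed.

End PLGroup.

Arguments ap {R} f%_g x.

(** * Supports and interpolation *)

Section Supports.
Variable R : realType.
Notation plG := (plG R).
Implicit Types (f g h u v : plG) (a b c d p x y : R) (G H : plG -> Prop).

Definition is_subgroup G := G 1%g /\ forall f g, G f -> G g -> G (f * g^-1)%g.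

Lemma subgroup1 G : is_subgroup G -> G 1%g. Proof. by case. Qed.

Lemma subgroupV G f : is_subgroup G -> G f -> G f^-1%g.
Proof. by move=> [G1 Gm] Gf; rewrite -[f^-1%g]mul1g; exact: Gm. Qed.

Lemma subgroupM G f g : is_subgroup G -> G f -> G g -> G (f * g)%g.
Proof.
by move=> sG Gf Gg; rewrite -[g]invgK; apply: (proj2 sG) => //;
  exact: subgroupV.
Qed.

Lemma subgroupJ G f g : is_subgroup G -> G f -> G g -> G (f ^ g)%g.
Proof.
by move=> sG Gf Gg; rewrite conjgE; do 2?apply: subgroupM => //;
  exact: subgroupV.
Qed.

Lemma subgroupR G f g : is_subgroup G -> G f -> G g -> G [~ f, g]%g.
Proof.
by move=> sG Gf Gg; apply: subgroupM => //; [exact: subgroupV|exact: subgroupJ].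
Qed.

Lemma subgroupX G f n : is_subgroup G -> G f -> G (f ^+ n)%g.
Proof.
move=> sG Gf; elim: n => [|n IH]; first exact: subgroup1.
by rewrite expgS; exact: subgroupM.
Qed.

Definition supp a b f := forall x, x <= a \/ b <= x -> f x = x.

Lemma supp_subgroup a b : is_subgroup (supp a b).
Proof.
split=> [//|f g sf sg x hx].
by rewrite plGME sf//; apply: plG_eqV; exact: sg.
Qed.

Lemma suppJ a b f g : supp a b f -> supp (g a) (g b) (f ^ g)%g.
Proof.
move=> sf x hx; rewrite plGJE sf ?plGVK//.
by rewrite plG_leV plG_geV.
Qed.

Lemma suppW a b c d f : supp a b f -> c <= a -> b <= d -> supp c d f.
Proof. by move=> sf ca bd x hx; apply: sf; lra. Qed.

Lemma supp_itv a b f x : supp a b f -> a < x < b -> a < f x < b.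
Proof.
move=> sf /andP[ax xb]; rewrite -{1}(sf a) ?plG_lt ?ax /=; last by left.
by rewrite -(sf b) ?plG_lt//; right.
Qed.

Lemma supp_itvc a b f x : supp a b f -> a <= x <= b -> a <= f x <= b.
Proof.
move=> sf /andP[ax xb]; rewrite -{1}(sf a) ?plG_le ?ax /=; last by left.
by rewrite -(sf b) ?plG_le//; right.
Qed.

Lemma supp_commute a b c d f g : supp a b f -> supp c d g -> b <= c ->
  (f * g = g * f)%g.
Proof.
move=> sf sg bc; apply: plG_inj => x; rewrite !plGME.
have fb : f b = b by apply: sf; right.
have gc : g c = c by apply: sg; left.
have [xb|bx] := leP x b.
  have fxb : f x <= b by rewrite -fb plG_le.
  by rewrite (sg (f x)) ?(sg x)//; left; lra.
rewrite (sf x); last by right; exact: ltW.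
rewrite (sf (g x))//; right; have [xc|cx] := leP x c.
  by rewrite (sg x); [exact: ltW|left].
by apply: le_trans bc _; rewrite -gc plG_le ltW.
Qed.

Lemma plG_paste f g p : dyadic p -> f p = g p ->
  exists h, (forall x, x <= p -> h x = f x) /\ (forall x, p <= x -> h x = g x).
Proof.
move=> dp fg; exists (PlG (pl2_paste dp fg (plGP f) (plGP g))).
by split => x ?; [exact: pasteL|exact: pasteR].
Qed.

Lemma plG_affine (k : int) d : dyadic d -> exists h, forall x,
  h x = 2 ^ k * x + d.
Proof. by move=> dd; exists (PlG (pl2_affine k dd)). Qed.

Lemma dyadicB x y : dyadic x -> dyadic y -> dyadic (x - y).
Proof. by move=> dx dy; apply/dyadicD => //; exact: dyadicN. Qed.

Lemma dyadic_nat (n : nat) : dyadic (n%:R : R).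
Proof. by exists n%:Z, 0%N; rewrite divr1. Qed.

Lemma dyadic_gt0 x : dyadic x -> 0 < x -> exists m n : nat,
  x = m.+1%:R / 2 ^+ n.
Proof.
move=> [m [n ->]]; rewrite pmulr_lgt0 ?invr_gt0 ?exprn_gt0// ltr0z.
by case: m => [[|m]|m]// _; exists m, n.
Qed.

Lemma plG_stretch (m n : nat) : exists h : plG, h 0 = 0 /\ h m.+1%:R = n.+1%:R.
Proof.
suff up k l : exists h : plG, h 0 = 0 /\ h k.+1%:R = (k + l).+1%:R.
  have [mn|nm] := leqP m n; first by rewrite -(subnKC mn); exact: up.
  have [h [h0 h1]] := up n (m - n)%N; exists h^-1%g; rewrite -{1}h0 plGK;
    split => //.
  by rewrite -(subnKC (ltnW nm)) -h1 plGK.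
elim: l => [|l [h [h0 h1]]]; first by exists 1%g; rewrite addn0.
have [f fE] := plG_affine 1 (dyadic_nat 0).
have [g gE] := plG_affine 0 (dyadic_nat 1).
(* Doubling below 1 and adding 1 above it: 0 is fixed and each positive integer is sent to its
   successor. *)
have [|e [e1 e2]] := @plG_paste f g 1 (dyadic_nat 1).
  by rewrite fE gE expr0z expr1z; lra.
exists (h * e)%g; rewrite !plGME h0 h1; split.
  by rewrite e1 ?ler01// fE mulr0 addr0.
by rewrite e2 ?ler1n// gE expr0z mul1r addnS [RHS]mulrSr.
Qed.

(** Scaling by powers of 2 turns both lengths into positive integers, where [plG_stretch]
    applies. *)
Lemma plG_interp a b c d : dyadic a -> dyadic b -> dyadic c -> dyadic d ->
  a < b -> c < d -> exists h : plG, h a = c /\ h b = d.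
Proof.
move=> da db dc dd ab cd.
have [m [n mn]] : exists m n : nat, b - a = m.+1%:R / 2 ^+ n.
  by apply: dyadic_gt0; rewrite ?subr_gt0//; exact: dyadicB.
have [m' [n' mn']] : exists m n : nat, d - c = m.+1%:R / 2 ^+ n.
  by apply: dyadic_gt0; rewrite ?subr_gt0//; exact: dyadicB.
have [f fE] := @plG_affine n%:Z (- (2 ^ n%:Z * a)) (dyadicN (dyadicM_pow2 _
  da)).
have [g gE] := @plG_affine (- n'%:Z) c dc.
have [h [h0 h1]] := plG_stretch m m'.
have p0 k : (2 : R) ^+ k != 0 by rewrite expf_neq0.
exists (f * h * g)%g; rewrite !plGME !fE !gE addrN h0 mulr0 add0r; split => //.
rewrite -mulrBr mn mulrCA -exprnP divff// mulr1 h1 -exprnN.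
by move: mn'; rewrite mulrC => <-; ring.
Qed.

End Supports.

Arguments suppJ {R a b f} g sf.

(** * Two generators acting on standard dyadic partitions *)

Section Generators.
Variable R : realType.
Notation plG := (plG R).
Implicit Types (f g h u v : plG) (a b c d p x y : R) (G H : plG ->
  Prop) (s : seq R).

(** Up to inversion this is one of the two standard generators of F; the other, [gen1], is its copy
    on [1/2, 1]. *)
Lemma gen0_ex : exists h : plG, [/\ forall x, x <= 0 \/ 1 <= x -> h x = x,
  forall x, 0 <= x <= 4^-1 -> h x = 2 * x,
  forall x, 4^-1 <= x <= 2^-1 -> h x = x + 4^-1 &
  forall x, 2^-1 <= x <= 1 -> h x = (x + 1) / 2].
Proof.
have d4 : dyadic (4^-1 : R) by exists 1, 2%N; rewrite mul1r; congr (_^-1); ring.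
have d2 : dyadic (2^-1 : R) by exists 1, 1%N; rewrite mul1r expr1.
have [f fE] := plG_affine (-1) d2.
have [|e1 [e1L e1R]] := @plG_paste R f 1%g 1 (@dyadic1 R).
  by rewrite fE plG1E exprN1; lra.
have [f2 f2E] := plG_affine 0 d4.
have [|e2 [e2L e2R]] := @plG_paste R f2 e1 2^-1 d2.
  by rewrite f2E e1L; [rewrite fE expr0z exprN1; lra|lra].
have [f3 f3E] := plG_affine 1 (@dyadic0 R).
have [|e3 [e3L e3R]] := @plG_paste R f3 e2 4^-1 d4.
  by rewrite f3E e2L; [rewrite f2E expr0z expr1z; lra|lra].
have [|e [eL eR]] := @plG_paste R 1%g e3 0 (@dyadic0 R).
  by rewrite e3L; [rewrite f3E plG1E expr1z; lra|lra].
exists e; split => x hx.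
- have [x0|x1] := hx; first by rewrite eL.
  by rewrite eR ?e3R ?e2R ?e1R ?plG1E; lra.
- by rewrite eR ?e3L ?f3E ?expr1z; lra.
- by rewrite eR ?e3R ?e2L ?f2E ?expr0z; lra.
- by rewrite eR ?e3R ?e2R ?e1L ?fE ?exprN1; lra.
Qed.

Definition gen0 : plG := sval (cid gen0_ex).

Lemma gen0_supp : supp 0 1 gen0.
Proof. by rewrite /gen0; case: cid => h []. Qed.

Lemma gen0_1 x : 0 <= x <= 4^-1 -> gen0 x = 2 * x.
Proof. by rewrite /gen0; case: cid => h [] /= _ hE _ _ /hE. Qed.

Lemma gen0_2 x : 4^-1 <= x <= 2^-1 -> gen0 x = x + 4^-1.
Proof. by rewrite /gen0; case: cid => h [] /= _ _ hE _ /hE. Qed.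

Lemma gen0_3 x : 2^-1 <= x <= 1 -> gen0 x = (x + 1) / 2.
Proof. by rewrite /gen0; case: cid => h [] /= _ _ _ hE /hE. Qed.

Lemma halve_ex : exists h : plG, forall x, h x = (x + 1) / 2.
Proof.
have d2 : dyadic (2^-1 : R) by exists 1, 1%N; rewrite mul1r expr1.
by have [h hE] := plG_affine (-1) d2; exists h => x; rewrite hE exprN1; lra.
Qed.

Definition halve : plG := sval (cid halve_ex).

Lemma halveE x : halve x = (x + 1) / 2.
Proof. by rewrite /halve; case: cid => h /= ->. Qed.

Lemma halveVE x : ap halve^-1 x = 2 * x - 1.
Proof. by apply: (@plG_injE R halve); rewrite plGVK halveE; lra. Qed.

Definition gen1 : plG := (gen0 ^ halve)%g.

Lemma gen1_supp : supp 2^-1 1 gen1.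
Proof.
have := suppJ halve gen0_supp; rewrite !halveE.
have -> : (0 + 1) / 2 = 2^-1 :> R by lra.
by have -> : (1 + 1) / 2 = 1 :> R by lra.
Qed.

(** [gen0] and [halve] coincide on [1/2, 1], which contains the support of [gen1]. *)
Lemma gen1J : (gen1 ^ halve = gen1 ^ gen0)%g.
Proof.
apply: plG_inj => x; have [x34|x34] := leP x (3 / 4).
  have -> : ap (gen1 ^ halve) x = x.
    by apply: (suppJ halve gen1_supp); left; rewrite halveE; lra.
  apply/esym/(suppJ gen0 gen1_supp); left.
  by rewrite gen0_3; lra.
have [x1|x1] := leP 1 x.
  rewrite (suppJ halve gen1_supp); last by right; rewrite halveE; lra.
  rewrite (suppJ gen0 gen1_supp)//; right.
  by rewrite (gen0_supp (x := 1))//; right.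
have xE : x = gen0 (2 * x - 1) by rewrite gen0_3; lra.
have xE' : x = halve (2 * x - 1) by rewrite halveE; lra.
rewrite [in LHS]xE' [in RHS]xE !plGJ.
have /andP[h1 h2] : 2^-1 < gen1 (2 * x - 1) < 1.
  by apply: (supp_itv gen1_supp); lra.
by rewrite halveE gen0_3//; lra.
Qed.

Definition std a b := exists (m : int) (n : nat),
  a = m%:~R / 2 ^+ n /\ b = (m + 1)%:~R / 2 ^+ n.

(* a :: s subdivides [a, last a s] into standard dyadic intervals
   [m / 2^n, (m + 1) / 2^n]. *)
Fixpoint chain a s : Prop :=
  if s is b :: s' then std a b /\ chain b s' else True.

Definition aff (f : R -> R) a b := exists k c, forall x, a <= x <= b ->
  f x = k * x + c.

Fixpoint affs (f : R -> R) a s : Prop :=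
  if s is b :: s' then aff f a b /\ affs f b s' else True.

(* The subdivision 1/2, 3/4, 7/8, ..., 1 of [0, 1]. *)
Fixpoint vine n : seq R :=
  if n is m.+1 then (if m is 0%N then [:: 1] else 2^-1 :: map halve (vine m))
  else [::].

Lemma std_lt a b : std a b -> a < b.
Proof.
move=> [m [n [-> ->]]]; rewrite ltr_pM2r ?invr_gt0 ?exprn_gt0// ltr_int; lia.
Qed.

Lemma chain_le a s : chain a s -> a <= last a s.
Proof. by elim: s a => //= b s IH a [/std_lt ab /IH]; apply/le_trans/ltW. Qed.

Lemma aff_comp f g a b : aff f a b -> aff g (f a) (f b) -> aff (ap (f * g)) a b.
Proof.
move=> [k [c fE]] [l [d gE]]; exists (l * k), (l * c + d) => x /andP[ax xb].
by rewrite plGME gE ?plG_le ?ax// fE ?ax//; ring.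
Qed.

Lemma affs_comp f g a s : affs f a s -> affs g (f a) (map f s) ->
  affs (ap (f * g)) a s.
Proof.
elim: s a => //= b s IH a [fab fbs] [gab gbs]; split; first exact: aff_comp.
exact: IH.
Qed.

Lemma aff_affs f a s : (exists k c, forall x, f x = k * x + c) -> affs f a s.
Proof.
move=> fE; elim: s a => //= b s IH a; split => //.
by have [k [c {}fE]] := fE; exists k, c.
Qed.

(** An affine piece is determined by its values at its two ends. *)
Lemma affs_eq f g a s x : chain a s -> affs f a s -> affs g a s -> f a = g a ->
  map f s = map g s -> a <= x <= last a s -> f x = g x.
Proof.
elim: s a => /= [a _ _ _ fg _ ax|b s IH a [sab cs] [[k [c fE]] fs] [[l [d gE]]
  gs]].
  by have -> : x = a by apply/le_anti; rewrite andbC.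
move=> fga [fgb fgs] /andP[ax xl].
have [xb|bx] := leP x b; last first.
  by apply: (IH b cs) => //; rewrite (ltW bx).
have ab := std_lt sab.
move: fga fgb; rewrite !fE ?gE ?lexx ?ax ?(ltW ab)// => fga fgb.
have kl : k = l.
  by apply: (@mulIf _ (b - a)); [rewrite subr_eq0 gt_eqF|lra].
by move: fga; rewrite kl => fga; lra.
Qed.

(** After scaling by 2^n all three numbers are integers, and none lies strictly between m and m +
    1. *)
Lemma std_sep a b (j m : int) (e n : nat) : a = m%:~R / 2 ^+ n ->
  b = (m + 1)%:~R / 2 ^+ n -> (e <= n)%N ->
  b <= j%:~R / 2 ^+ e \/ j%:~R / 2 ^+ e <= a.
Proof.
move=> -> -> en.
have -> : j%:~R / 2 ^+ e = (j * 2 ^+ (n - e))%:~R / 2 ^+ n :> R.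
  by apply/eqP; rewrite eqr_div ?expf_neq0// rmorphM rmorphXn /= -mulrA -exprD
    subnK.
rewrite !ler_pM2r ?invr_gt0 ?exprn_gt0// !ler_int; lia.
Qed.

Lemma chain_half_inv a s : 2^-1 <= a -> chain a s -> last a s <= 1 ->
  chain (ap halve^-1 a) (map (ap halve^-1) s).
Proof.
elim: s a => //= b s IH a a2 [sab cs] l1.
have ab := std_lt sab; split; last by apply: IH => //; lra.
have b1 : b <= 1 by apply: le_trans l1; exact: chain_le.
case: sab => m [[|n] [aE bE]].
  by move: ab b1 a2; rewrite bE aE !expr0 !divr1 rmorphD /=; lra.
exists (m - 2 ^+ n), n; rewrite !halveVE aE bE !rmorphD rmorphN rmorphXn /=
  exprS.
have p0 : (2 : R) ^+ n != 0 by rewrite expf_neq0.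
by split; field.
Qed.

(** By [std_sep] the interval lies in one of the three affine pieces of [gen0], each of which shifts
    the level or translates on a compatible grid. The condition 0 < a rules out [0, 1/2] and [0, 1],
    the only standard intervals in [0, 1] straddling 1/4. *)
Lemma gen0_std a b : std a b -> 0 < a -> b <= 1 ->
  aff gen0 a b /\ std (gen0 a) (gen0 b).
Proof.
move=> sab a0 b1; have ab := std_lt sab.
have p0 k : (2 : R) ^+ k != 0 by rewrite expf_neq0.
have [b4|a4] : b <= 4^-1 \/ 4^-1 <= a.
  case: sab => m [n [aE bE]].
  have -> : 4^-1 = 1%:~R / 2 ^+ 2 :> R by rewrite mul1r; congr (_^-1); ring.
  have [n2|n2] := leqP 2 n; first exact: std_sep aE bE n2.
  (* At level 0 or 1, a positive left end is at least 1/2. *)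
  right; rewrite aE pmulr_lgt0 ?invr_gt0 ?exprn_gt0// ltr0z in a0.
  have m1 : 1 <= m%:~R :> R by rewrite ler1z; lia.
  by case: n n2 aE {bE} => [|[|n]]// _ ->; rewrite ?expr0 ?expr1; lra.
- split; first by exists 2, 0 => x hx; rewrite gen0_1 ?addr0//; lra.
  case: sab => m [[|n] [aE bE]].
    by move: b4 a0; rewrite aE bE !expr0 !divr1 rmorphD /=; lra.
  exists m, n; rewrite !gen0_1; [|lra..].
  by rewrite aE bE exprS; split; field.
- have [b2|a2] : b <= 2^-1 \/ 2^-1 <= a.
    case: sab => m [[|n] [aE bE]].
      by move: ab b1 a4; rewrite aE bE !expr0 !divr1 rmorphD /=; lra.
    have -> : 2^-1 = 1%:~R / 2 ^+ 1 :> R by rewrite mul1r expr1.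
    exact: std_sep aE bE _.
  split; first by exists 1, 4^-1 => x hx; rewrite gen0_2 ?mul1r//; lra.
  case: sab => m [[|[|n]] [aE bE]].
  + by move: b1 a4; rewrite aE bE !expr0 !divr1 rmorphD /=; lra.
  + by move: b2 a4; rewrite aE bE !expr1 rmorphD /=; lra.
  exists (m + 2 ^+ n), n.+2; rewrite !gen0_2; [|lra..].
  by rewrite aE bE !rmorphD rmorphXn /= !exprS; split; field.
split; first by exists 2^-1, 2^-1 => x hx; rewrite gen0_3 ?mul1r//; lra.
case: sab => m [n [aE bE]].
exists (m + 2 ^+ n), n.+1; rewrite !gen0_3; [|lra..].
by rewrite aE bE !rmorphD rmorphXn /= !exprS; split; field.
Qed.

Lemma gen0_chain a s : 0 < a -> chain a s -> last a s <= 1 ->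
  chain (gen0 a) (map gen0 s) /\ affs gen0 a s.
Proof.
elim: s a => //= b s IH a a0 [sab cs] l1.
have b1 : b <= 1 by apply: le_trans l1; exact: chain_le.
have [? ?] := gen0_std sab a0 b1.
by have [? ?] := IH b (lt_trans a0 (std_lt sab)) cs l1.
Qed.

(** Quantifying over all such G stands for membership in the generated subgroup, and lets an
    induction hypothesis be used with another G, as [gen_closed_half] provides. *)
Definition gen_closed G := [/\ is_subgroup G, G gen0 & G gen1].

(* gen1^halve = gen1^gen0, so the conjugate by halve of the subgroup generated
   by gen0 and gen1 is contained in it. *)
Lemma gen_closed_half G : gen_closed G ->
  gen_closed (fun g => [/\ supp 0 1 g, G g & G (g ^ halve)%g]).
Proof.
move=> [sG G0 G1].
have s1 : supp 0 1 gen1 by apply: suppW gen1_supp _ _; lra.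
split; last 2 first.
- by split => //; exact: gen0_supp.
- by split => //; rewrite gen1J; exact: subgroupJ.
split; first by rewrite conj1g; split => //; exact: subgroup1.
move=> f g [sf Gf Gfh] [sg Gg Ggh]; split.
- by have [_] := supp_subgroup (R := R) 0 1; exact.
- exact: (proj2 sG).
- by rewrite conjMg conjVg; exact: (proj2 sG).
Qed.

(* If the first interval of the subdivision is [0, 1/2], the rest is treated by
   induction in the copy of the generators on [1/2, 1]; otherwise gen0 doubles
   its first interval. *)
Lemma chain_vine s : chain 0 s -> last 0 s = 1 -> forall G, gen_closed G ->
  exists h, [/\ G h, supp 0 1 h, affs h 0 s & map h s = vine (size s)].
Proof.
move: {2}(size s) (erefl (size s)) => N; elim: N s => [|N IHN] [|b s]//=.
  by move=> _ _ /eqP; rewrite eq_sym oner_eq0.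
move=> [sN] [[m [n [/esym/eqP]]]].
(* A standard interval starting at 0 is [0, 2^-n]; the second induction below is on this n. *)
rewrite mulf_eq0 invr_eq0 expf_eq0 pnatr_eq0 andbF orbF intr_eq0 => /eqP -> bE.
move: bE; rewrite add0r mul1r => -> {m b}.
case: s sN => [|c s] sN.
  move=> _ /= n1 G [sG _ _]; exists 1%g; split => //.
  - exact: subgroup1.
  - by split => //; exists 1, 0 => x _; rewrite addr0 mul1r.
  - by rewrite n1.
elim: n c s sN => [|n IHn] c s sN cs ls.
  (* The first interval would be [0, 1], leaving no room for [c]. *)
  rewrite expr0 invr1 in cs ls; case: cs => /std_lt c1 /chain_le.
  by move: ls => /= ->; lra.
move=> G gG; have [sG G0 G1] := gG.
case: n IHn cs ls => [_|n IHn] cs ls.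
  rewrite expr1 in cs ls *.
  have ct : chain (ap halve^-1 2^-1) (map (ap halve^-1) (c :: s)).
    by apply: chain_half_inv => //; rewrite ls.
  have h2 : ap halve^-1 2^-1 = 0 by rewrite halveVE; lra.
  rewrite h2 in ct.
  have [||h [[sh Gh Ghh] _ ah hs]] := IHN _ _ ct _ _ (gen_closed_half gG).
  - by rewrite size_map.
  - by rewrite -{1}h2 last_map ls halveVE; lra.
  exists (h ^ halve)%g; split => //.
  + by apply: suppW (suppJ halve sh) _ _; rewrite halveE; lra.
  + split.
      exists 1, 0 => x hx; rewrite mul1r addr0.
      by apply: (suppJ halve sh); left; rewrite halveE; lra.
    rewrite conjgE mulgA; apply: affs_comp.
      apply: affs_comp; last by rewrite h2.
      by apply: aff_affs; exists 2, (-1) => x; rewrite halveVE.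
    by apply: aff_affs; exists 2^-1, 2^-1 => x; rewrite halveE; lra.
  + rewrite map_cons; congr (_ :: _).
      by apply: (suppJ halve sh); left; rewrite halveE; lra.
    move: hs; rewrite size_map => <-; rewrite -!map_comp.
    by rewrite -[LHS]/(map (ap (h ^ halve)) (c :: s)); apply: eq_map => x;
      rewrite plGJE.
have p2 : (2^-1 : R) ^+ n.+2 <= 4^-1.
  have -> : 4^-1 = (2^-1 : R) ^+ 2 by rewrite exprVn; congr (_^-1); ring.
  by apply: ler_wiXn2l => //; lra.
rewrite -exprVn in cs ls *.
have p0 : 0 < (2^-1 : R) ^+ n.+2 by rewrite exprn_gt0.
have [|cs' as'] := @gen0_chain ((2^-1) ^+ n.+2) (c :: s) p0 cs;
  first by rewrite ls.
have g0 : gen0 ((2^-1) ^+ n.+2) = (2 ^+ n.+1)^-1.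
  by rewrite gen0_1 ?(ltW p0)// -exprVn [in LHS]exprS; lra.
rewrite g0 in cs'.
have [||h [Gh sh ah hs]]  := IHn (gen0 c) (map gen0 s) _ cs' _ G gG.
- by rewrite /= size_map.
- rewrite -g0 -[RHS](@gen0_supp 1); last by right.
  by rewrite -[in RHS]ls; exact: (last_map gen0 (c :: s)).
exists (gen0 * h)%g; split.
- exact: subgroupM.
- exact: subgroupM (supp_subgroup 0 1) gen0_supp sh.
- apply: (@affs_comp _ h 0 (_ :: c :: s)).
    by split => //; exists 2, 0 => x hx; rewrite gen0_1; lra.
  by rewrite (gen0_supp (x := 0)); [rewrite /= g0|left].
- move: hs; rewrite /= size_map => <-.
  by rewrite plGME g0; congr (_ :: _ :: _); rewrite -map_comp; exact: eq_map.
Qed.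

End Generators.

(** * The two generators generate *)

Section Generation.
Variable R : realType.
Notation plG := (plG R).
Implicit Types (f g h u v : plG) (a b c d p x y : R) (G H : plG ->
  Prop) (s : seq R).

Lemma pow2_shift (k : int) (e : nat) : exists n0, forall n, (n0 <= n)%N ->
  exists2 N : nat, (e <= N)%N & 2 ^ k / 2 ^+ n = (2 ^+ N)^-1 :> R.
Proof.
exists (`|k| + e)%N => n hn; exists `|n%:Z - k|%N; first lia.
have -> : (n%:Z - k) = `|n%:Z - k|%N :> int by lia.
rewrite absz_nat exprnN exprnN -expfzDr ?pnatr_eq0//; congr (_ ^ _); lia.
Qed.

(** An affine map of slope 2^k sends a cell of level n to an interval of length 2^(k - n), which is
    standard once the grid of that mesh contains the translation constant. *)
Lemma pl2_std (f : R -> R) : pl2 f -> exists n0, forall n (m : int),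
  (n0 <= n)%N ->
  aff f (m%:~R / 2 ^+ n) ((m + 1)%:~R / 2 ^+ n) /\
  std (f (m%:~R / 2 ^+ n)) (f ((m + 1)%:~R / 2 ^+ n)).
Proof.
elim=> [k d [j [e ->]]|{}f g _ [j [e ->]] fg _ [n1 IH1] _ [n2 IH2]].
  have [n0 hn0] := pow2_shift k e; exists n0 => n m /hn0 [N eN kN].
  split; first by exists (2 ^ k), (j%:~R / 2 ^+ e) => x _.
  exists (m + j * 2 ^+ (N - e)), N.
  have jE : j%:~R / 2 ^+ e = (j * 2 ^+ (N - e))%:~R / 2 ^+ N :> R.
    by apply/eqP; rewrite eqr_div ?expf_neq0// rmorphM rmorphXn /= -mulrA -exprD
      subnK.
  by rewrite jE ![2 ^ k * _]mulrCA kN !rmorphD /=; split; ring.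
(* A level of at least e puts the gluing point j / 2^e on the grid, so no cell straddles it. *)
exists (e + n1 + n2)%N => n m hn.
have [|bp|pa] := @std_sep R _ _ j m e n erefl erefl; first lia.
  rewrite ![paste _ _ _ (_ / _)]pasteL//; last first.
    by apply: le_trans bp; rewrite ler_pM2r ?invr_gt0 ?exprn_gt0// ler_int; lia.
  have [|[k [c fE]] sf] := IH1 n m; first lia.
  split => //; exists k, c => x hx; rewrite pasteL ?fE//; lra.
have pb : j%:~R / 2 ^+ e <= (m + 1)%:~R / 2 ^+ n :> R.
  by apply: le_trans pa _; rewrite ler_pM2r ?invr_gt0 ?exprn_gt0// ler_int; lia.
rewrite ![paste _ _ _ (_ / _)](pasteR fg)//.
have [|[k [c gE]] sg] := IH2 n m; first lia.
split => //; exists k, c => x hx; rewrite (pasteR fg) ?gE//; lra.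
Qed.

Definition grid n i l : seq R := [seq k.+1%:R / 2 ^+ n | k <- iota i l].

Lemma grid_last n i l : last (i%:R / 2 ^+ n) (grid n i l) = (i + l)%:R / 2 ^+ n.
Proof. by elim: l i => [|l IH] i /=; rewrite ?addn0// IH addSnnS. Qed.

Lemma grid_chain (h : plG) n i l : (forall m : int,
  aff h (m%:~R / 2 ^+ n) ((m + 1)%:~R / 2 ^+ n) /\
  std (h (m%:~R / 2 ^+ n)) (h ((m + 1)%:~R / 2 ^+ n))) ->
  [/\ chain (i%:R / 2 ^+ n) (grid n i l), affs h (i%:R / 2 ^+ n) (grid n i l) &
  chain (h (i%:R / 2 ^+ n)) (map h (grid n i l))].
Proof.
move=> hs; elim: l i => //= l IH i; have [? ? ?] := IH i.+1.
have iE : i.+1%:R = (i%:Z + 1)%:~R :> R by rewrite rmorphD /= -mulrSr.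
have [? ?] := hs i; split; split => //; rewrite iE//.
by exists i, n.
Qed.

(** On a fine enough grid, [h] maps one standard subdivision to another with as many intervals.
    Elements [u] and [v] of G carry both to the same [vine], hence h v = u. *)
Lemma gen_full G h : gen_closed G -> supp 0 1 h -> G h.
Proof.
move=> gG sh; have [sG _ _] := gG.
have [n hn] := pl2_std (plGP h).
have [] := @grid_chain h n 0 (2 ^ n) (fun m => hn n m (leqnn n)).
have := grid_last n 0 (2 ^ n); set s := grid n 0 (2 ^ n).
have p0 : (2 : R) ^+ n != 0 by rewrite expf_neq0.
rewrite mul0r add0n natrX divff// => ls cs as_ cs'.
have h0 : h 0 = 0 by apply: sh; left.
have h1 : h 1 = 1 by apply: sh; right.
have [u [Gu su au us]] := chain_vine cs ls gG.
rewrite h0 in cs'.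
have ls' : last 0 (map h s) = 1 by rewrite -{1}h0 last_map ls.
have [v [Gv sv av vs]] := chain_vine cs' ls' gG.
have u0 : u 0 = 0 by apply: su; left.
have v0 : v 0 = 0 by apply: sv; left.
have huv : (h * v = u)%g.
  apply: plG_inj => x.
  have [x01|/negP x01] := boolP (0 <= x <= 1); last first.
    have hx : x <= 0 \/ 1 <= x by case: (leP x 0); [left|right; lra].
    by rewrite plGME sh// sv// su.
  apply: (@affs_eq R (h * v)%g u 0 s x); rewrite ?ls//.
  - by apply: affs_comp => //; rewrite h0.
  - by rewrite plGME h0 v0 u0.
  - by rewrite us -(size_map h s) -vs -map_comp.
have -> : h = (u * v^-1)%g by rewrite -huv mulgK.
exact: (proj2 sG).
Qed.

End Generation.

(** * Germs and perfectness *)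

Section Germs.
Variable R : realType.
Notation plG := (plG R).
Implicit Types (f g h u v : plG) (a b c d p x y : R) (G H : plG ->
  Prop) (k l : int).

(* For s = 1 or s = -1: p is fixed by f, and on the side s of p the slope of f
   is 2^k. *)
Definition germ (s p : R) f k :=
  exists2 e : R, 0 < e & forall t, 0 <= t <= e ->
    f (p + s * t) = p + s * (2 ^ k * t).

Lemma germ1g s p : germ s p 1%g 0.
Proof. by exists 1 => // t _; rewrite expr0z mul1r. Qed.

Lemma germM s p f g k l : germ s p f k -> germ s p g l ->
  germ s p (f * g)%g (k + l).
Proof.
move=> [e e0 fE] [e' e'0 gE]; have k0 := pow2_gt0 R k.
exists (Num.min e (e' / 2 ^ k)); first by rewrite lt_min e0 divr_gt0.
move=> t /andP[t0]; rewrite le_min => /andP[te te'].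
rewrite plGME fE ?t0// gE; last by rewrite mulr_ge0 ?(ltW k0)//= mulrC
  -ler_pdivlMr.
by rewrite mulrA -expfzDr ?pnatr_eq0// [(l + k)%R]addrC.
Qed.

Lemma germV s p f k : germ s p f k -> germ s p f^-1%g (- k).
Proof.
move=> [e e0 fE]; have k0 := pow2_gt0 R k; exists (e * 2 ^ k);
  first exact: mulr_gt0.
move=> t /andP[t0 te]; apply: (@plG_injE R f); rewrite plGVK fE.
  by rewrite mulrA -expfzDr ?pnatr_eq0// addrN expr0z mul1r.
by rewrite -invr_expz mulr_ge0 ?invr_ge0 ?exprz_ge0//= mulrC ler_pdivrMr.
Qed.

Lemma germX s p f k n : germ s p f k -> germ s p (f ^+ n)%g (k *+ n).
Proof.
move=> fk; elim: n => [|n IH]; first exact: germ1g.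
by rewrite expgSr mulrSr; exact: germM.
Qed.

Lemma germ_inj s p f k l : s != 0 -> germ s p f k -> germ s p f l -> k = l.
Proof.
move=> s0 [e e0 fk] [e' e'0 fl]; pose t := Num.min e e'.
have t0 : 0 < t by rewrite lt_min e0.
have := fk t; rewrite fl ?(ltW t0) ?ge_min ?lexx ?orbT// => /(_ isT).
move=> /addrI /(mulfI s0) /(mulIf (lt0r_neq0 t0)) h.
by apply/esym/(@ieexprIz R 2) => //; rewrite ?gt_eqF ?ltr1n.
Qed.

Lemma germ_commg s p f g k l : germ s p f k -> germ s p g l ->
  germ s p [~ f, g]%g 0.
Proof.
move=> fk gl; rewrite commgEl conjgE.
rewrite (_ : 0 = - k + (- l + (k + l))); last by lia.
by apply: germM (germV fk) _; apply: germM (germV gl) (germM fk gl).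
Qed.

Lemma germ0_ex f : f 0 = 0 -> exists k, germ 1 0 f k.
Proof.
move=> f0; have [k [e [e0 fE]]] := pl2_right 0 (plGP f).
exists k, e => // t /andP[t0 te]; rewrite !add0r !mul1r fE ?f0; first by ring.
by rewrite t0 add0r.
Qed.

Lemma germ1_ex f : f 1 = 1 -> exists k, germ (-1) 1 f k.
Proof.
move=> f1; have [k [e [e0 fE]]] := pl2_left 1 (plGP f).
by exists k, e => // t /andP[t0 te]; rewrite fE ?f1; [ring|lra].
Qed.

Lemma germ_id s p f (e : R) : 0 < e -> (forall t, 0 <= t <= e ->
  f (p + s * t) = p + s * t) ->
  germ s p f 0.
Proof. by move=> e0 fE; exists e => // t /fE ->; rewrite expr0z mul1r. Qed.

(** This is the kernel of pi, seen inside [plG]. *)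
Definition inner f := [/\ supp 0 1 f, germ 1 0 f 0 & germ (-1) 1 f 0].

Lemma inner_subgroup : is_subgroup inner.
Proof.
split; first by split; [|exact: germ1g..].
move=> f g [sf f0 f1] [sg g0 g1]; split.
- exact: (proj2 (supp_subgroup _ _)).
- by rewrite -[0 : int]subr0; apply: germM => //; exact: germV.
- by rewrite -[0 : int]subr0; apply: germM => //; exact: germV.
Qed.

Lemma supp_end f a b : supp a b f -> f a = a /\ f b = b.
Proof. by move=> sf; split; apply: sf; [left|right]. Qed.

Lemma inner_commg f g : supp 0 1 f -> supp 0 1 g -> inner [~ f, g]%g.
Proof.
move=> sf sg; have [f0 f1] := supp_end sf; have [g0 g1] := supp_end sg.
have [k fk] := germ0_ex f0; have [l gl] := germ0_ex g0.
have [k' fk'] := germ1_ex f1; have [l' gl'] := germ1_ex g1.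
split; [|exact: germ_commg fk gl|exact: germ_commg fk' gl'].
exact: subgroupR (supp_subgroup 0 1) sf sg.
Qed.

Lemma half_pow_lt x : 0 < x -> exists n : nat, (2^-1) ^+ n < x.
Proof.
move=> x0; exists (Num.bound x^-1).
rewrite exprVn -(invrK x) ltf_pV2 ?posrE ?invr_gt0 ?exprn_gt0//.
have := @archi_boundP _ x^-1; rewrite invr_ge0 (ltW x0) invrK =>
  /(_ isT) /lt_trans; apply.
by rewrite -natrX ltr_nat ltn_expl.
Qed.

Lemma inner_supp f : inner f -> exists c d, [/\ dyadic c, dyadic d, 0 < c,
  c < d < 1 &
  supp c d f].
Proof.
move=> [sf [e e0 fe] [e' e'0 fe']].
(* The bound 1/2 ensures 2^-n < 1 - 2^-n. *)
have [|n n0] := @half_pow_lt (Num.min (Num.min e e') 2^-1).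
  by rewrite !lt_min e0 e'0 invr_gt0 ltr0n.
move: n0; rewrite !lt_min => /andP[/andP[ne ne'] n2].
have p0 : 0 < (2^-1 : R) ^+ n by rewrite exprn_gt0.
have dn : dyadic ((2^-1 : R) ^+ n) by exists 1, n; rewrite mul1r exprVn.
exists (2^-1 ^+ n), (1 - 2^-1 ^+ n); split => //.
- by apply: dyadicB => //; exact: dyadic1.
- by lra.
move=> x [xc|xd].
  have [x0|x0] := leP x 0; first by apply: sf; left.
  have := fe x; rewrite !add0r !mul1r ?expr0z ?mul1r; apply; lra.
have [x0|x0] := leP 1 x; first by apply: sf; right.
have := fe' (1 - x); rewrite expr0z mul1r.
have -> : 1 + -1 * (1 - x) = x by ring.
by apply; lra.
Qed.

Lemma supp_inner c d f : 0 < c -> d < 1 -> supp c d f -> inner f.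
Proof.
move=> c0 d1 sf; split.
- by apply: suppW sf _ _; exact: ltW.
- by apply: (@germ_id _ _ _ c) => // t ht; apply: sf; left; lra.
- by apply: (@germ_id _ _ _ (1 - d)) => [|t ht]; [lra|apply: sf; right; lra].
Qed.

Lemma germ_gen0 : germ 1 0 (gen0 R) 1.
Proof.
exists 4^-1 => [|t ht]; first by lra.
by rewrite !add0r !mul1r gen0_1.
Qed.

Lemma germ_gen1 : germ (-1) 1 (gen1 R) (-1).
Proof.
exists 4^-1 => [|t ht]; first by lra.
have -> : 1 + -1 * t = halve R (1 + -1 * (2 * t)) by rewrite halveE; lra.
by rewrite plGJ gen0_3 ?halveE ?exprN1; lra.
Qed.

(* Modulo commutators, f is gen0^i gen1^j, and its germs at 0 and 1 determine
   i and j. *)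
Lemma inner_in_commutators (N : plG -> Prop) : is_subgroup N ->
  (forall u v, supp 0 1 u -> supp 0 1 v -> N [~ u, v]%g) ->
  forall f, inner f -> N f.
Proof.
move=> sN Nc.
(* Integer powers of [u], written with two natural exponents. *)
pose P u m n : plG := (u ^+ m * (u ^+ n)^-1)%g.
have PM u m n : (P u m n * u)%g = P u m.+1 n.
  rewrite /P expgSr -!mulgA; congr (_ * _)%g.
  by apply/esym/commuteV/commuteX/commute_refl.
have PV u m n : (P u m n * u^-1)%g = P u m n.+1.
  by rewrite /P expgS invgM mulgA.
have s01 := @supp_subgroup R 0 1.
have sg0 := @gen0_supp R.
have sg1 : supp 0 1 (gen1 R) by apply: suppW (@gen1_supp R) _ _; lra.
pose S (y : plG) := exists m n m' n' (c : plG), [/\ N c, inner c &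
  y = (P (gen0 R) m n * P (gen1 R) m' n' * c)%g].
have sP u m n : supp 0 1 u -> supp 0 1 (P u m n).
  by move=> su; rewrite /P; by apply: (proj2 s01); exact: subgroupX s01 su.
have mvl (a b c z : plG) : (a * b * c * z = (a * z) * b * (c * [~ (b * c),
  z]))%g.
  by rewrite -(mulgA a b c) -mulgA (commgC (b * c)%g z) !mulgA.
have mvr (a b c z : plG) : (a * b * c * z = a * (b * z) * (c * [~ c, z]))%g.
  by rewrite -(mulgA (a * b)%g) (commgC c z) !mulgA.
have nc (c w z : plG) : N c -> inner c -> supp 0 1 w -> supp 0 1 z ->
    N (c * [~ w, z])%g /\ inner (c * [~ w, z])%g.
  move=> Nc' ic sw sz; split; apply: subgroupM => //;
    [exact: Nc|exact: inner_subgroup|].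
  exact: inner_commg.
(* The stabiliser of the set S of normal forms under right multiplication contains both generators,
   hence all of F by [gen_full]; applied to the identity it puts every element in normal form. *)
pose G (y : plG) := supp 0 1 y /\ forall s, S s ->
  S (s * y)%g /\ S (s * y^-1)%g.
have gG : gen_closed G.
  split.
  - split; first by split => // s; rewrite invg1 mulg1.
    move=> f g [sf fS] [sg gS]; split; first exact: (proj2 s01).
    move=> s Ss; rewrite invgM invgK !mulgA; split.
      by apply: (proj2 (gS _ _)); apply: (proj1 (fS _ _)).
    by apply: (proj2 (fS _ _)); apply: (proj1 (gS _ _)).
  - split=> // s [m [n [m' [n' [c [Nc' ic ->]]]]]].
    have sw : supp 0 1 (P (gen1 R) m' n' * c)%g.
      by apply: (subgroupM s01); [exact: sP|case: ic].
    split; rewrite mvl.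
      by rewrite PM; do 5!eexists; split; last by []; apply nc.
    rewrite PV; do 5!eexists; split; last by []; apply nc => //;
      exact: subgroupV s01 _.
  - split=> // s [m [n [m' [n' [c [Nc' ic ->]]]]]].
    have sw : supp 0 1 c by case: ic.
    split; rewrite mvr.
      by rewrite PM; do 5!eexists; split; last by []; apply nc.
    rewrite PV; do 5!eexists; split; last by []; apply nc => //;
      exact: subgroupV s01 _.
move=> f [sf f0 f1].
have [_ /(_ 1%g)[]] := gen_full gG sf.
  exists 0%N, 0%N, 0%N, 0%N, 1%g; split; first exact: subgroup1.
    exact: subgroup1 inner_subgroup.
  by rewrite /P !expg0 !invg1 !mulg1.
rewrite mul1g => -[m [n [m' [n' [c [Nc' [sc c0 c1] fE]]]]]] _.
have P1 s p u k i j : s != 0 -> k != 0 -> germ s p u k ->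
  germ s p (P u i j) 0 -> P u i j = 1%g.
  move=> s0 k0 uk uij.
  have /(germ_inj s0 uij) : germ s p (P u i j) (k *+ i - k *+ j).
    by apply: germM; [exact: germX|apply: germV; exact: germX].
  move=> kij; have ij : i = j by nia.
  by rewrite ij /P mulgV.
(* Powers of [gen1] are trivial near 0, so the germ at 0 detects the power of [gen0] alone; the germ
   at 1 then detects that of [gen1]. *)
have g10 i j : germ 1 0 (P (gen1 R) i j) 0.
  apply: (@germ_id _ _ _ 2^-1) => [|t ht]; first by lra.
  suff : supp 2^-1 1 (P (gen1 R) i j) by apply; left; lra.
  by have sh := @supp_subgroup R 2^-1 1; rewrite /P; apply: (proj2 sh);
    exact: subgroupX sh (@gen1_supp R).
have a1 : P (gen0 R) m n = 1%g.
  apply: (P1 1 0 _ 1) => //; first exact: germ_gen0.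
  have -> : P (gen0 R) m n = (f * (P (gen1 R) m' n' * c)^-1)%g by rewrite fE
    -(mulgA (P (gen0 R) m n)) mulgK.
  rewrite -[0 : int]subr0; apply: germM => //; apply: germV.
  by rewrite -[0 : int]addr0; exact: germM.
rewrite {}a1 mul1g in fE.
have b1 : P (gen1 R) m' n' = 1%g.
  apply: (P1 (-1) 1 _ (-1)) => //; first exact: germ_gen1.
  have -> : P (gen1 R) m' n' = (f * c^-1)%g by rewrite fE mulgK.
  by rewrite -[0 : int]subr0; apply: germM => //; exact: germV.
by rewrite fE b1 mul1g.
Qed.

End Germs.

(** * A contraction criterion *)

Section Contraction.
Variable R : realType.
Notation plG := (plG R).
Implicit Types (f g h u v w : plG) (a b c d p x y : R) (G H : plG ->
  Prop) (k n : plG).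

Lemma dyadic_dense x y : x < y -> exists2 d, dyadic d & x < d < y.
Proof.
move=> xy; have [|N hn] := @half_pow_lt R (y - x); first by rewrite subr_gt0.
rewrite exprVn in hn; have p0 : 0 < (2 : R) ^+ N by rewrite exprn_gt0.
exists ((Num.floor (x * 2 ^+ N) + 1)%:~R / 2 ^+ N); first by eexists _, _.
rewrite ltr_pdivlMr// ltr_pdivrMr//.
have := floor_le (x * 2 ^+ N); have := floorD1_gt (x * 2 ^+ N).
set z := Num.floor _; rewrite rmorphD /= => -> /= hz.
apply: le_lt_trans (lerD hz (lexx 1)) _.
rewrite -ltrBrDl -mulrBl -ltr_pdivrMr// mul1r //.
Qed.

(** [n, u] is [u] preceded by a conjugate of u^-1 supported in [n a, n b], to the right of the
    support of [v]; this factor commutes with [v] and drops out. *)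
Lemma double_commutator (n : plG) u v a b : supp a b u -> supp a b v ->
  b <= n a ->
  [~ [~ n, u], v]%g = [~ u, v]%g.
Proof.
move=> su sv ban; have sz : supp (n a) (n b) (u^-1 ^ n)%g.
  by apply: suppJ; apply: subgroupV su; exact: supp_subgroup.
set z := (u^-1 ^ n)%g in sz.
have nuE : [~ n, u]%g = (z * u)%g by rewrite commgEr.
have vz : (z ^ v)%g = z.
  by rewrite conjgE -(supp_commute sv sz ban) mulKg.
by rewrite nuE !commgEl conjMg vz invgM -mulgA mulKg.
Qed.

Lemma supp_interp a b x y x' y' : dyadic a -> dyadic b -> dyadic x ->
  dyadic y ->
  dyadic x' -> dyadic y' -> a < x -> x < y -> y < b -> a < x' -> x' < y' ->
    y' < b ->
  exists w, [/\ supp a b w, w x = x' & w y = y'].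
Proof.
move=> da db dx dy dx' dy' ax xy yb ax' xy' yb'.
have [f [fa fx]] := plG_interp da dx da dx' ax ax'.
have [g [gx gy]] := plG_interp dx dy dx' dy' xy xy'.
have [h [hy hb]] := plG_interp dy db dy' db yb yb'.
have [|e1 [e1L e1R]] := @plG_paste R h 1%g b db; first by rewrite hb.
have [|e2 [e2L e2R]] := @plG_paste R g e1 y dy;
  first by rewrite gy e1L ?hy ?ltW.
have [|e3 [e3L e3R]] := @plG_paste R f e2 x dx;
  first by rewrite fx e2L ?gx ?ltW.
have [|e4 [e4L e4R]] := @plG_paste R 1%g e3 a da; first by rewrite e3L ?fa ?ltW.
exists e4; split.
- move=> z [za|bz]; first by rewrite e4L.
  by rewrite e4R ?e3R ?e2R ?e1R ?plG1E; lra.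
- by rewrite e4R ?e3L ?fx; lra.
- by rewrite e4R ?e3R ?e2L ?gy; lra.
Qed.

Definition agree a b h u := forall x, a <= x <= b -> h x = u x.

Lemma agreeM a b h u k v : supp a b u -> agree a b h u -> agree a b k v ->
  agree a b (h * k)%g (u * v)%g.
Proof. by move=> su hu kv x hx; rewrite !plGME hu// kv//; exact: supp_itvc. Qed.

Lemma agreeV a b h u : supp a b u -> agree a b h u -> agree a b h^-1%g u^-1%g.
Proof.
move=> su hu x hx; apply: (@plG_injE R h); rewrite plGVK hu ?plGVK//.
exact: (supp_itvc (subgroupV (supp_subgroup a b) su)).
Qed.

Lemma agreeR a b h u k v : supp a b u -> supp a b v -> agree a b h u ->
  agree a b k v ->
  agree a b [~ h, k]%g [~ u, v]%g.
Proof.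
move=> su sv hu kv; rewrite !commgEl !conjgE.
have sS := supp_subgroup a b; have sVu := subgroupV sS su; have sVv :=
  subgroupV sS sv.
by do !apply: agreeM => //; exact: agreeV.
Qed.

(** A conjugate of [n] depends only on what the conjugator does on the support of [n], so an element
    of H inducing [u] can replace [u]. *)
Lemma agreeJ a b (n h : plG) u : supp a b n -> supp a b u -> agree a b h u ->
  (n ^ h = n ^ u)%g.
Proof.
move=> sn su hu; apply: plG_inj => x; rewrite !plGJE.
have [hx|hx] := boolP (a <= x <= b).
  rewrite (agreeV su hu)//.
  have vx := supp_itvc (subgroupV (supp_subgroup a b) su) hx.
  by rewrite hu//; exact: supp_itvc.
have hx' : x <= a \/ b <= x by move: hx; case: leP => /= ?; case: leP => // ?;
  lra.
have ab : a <= b \/ b < a by case: leP; [left|right].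
(* If b < a, the support condition forces [n] to be trivial. *)
case: ab => ab; last first.
  have n1 z : n z = z by apply: sn; case: (leP z a); [left|right; lra].
  by rewrite !n1 !plGVK.
have [ua ub] := supp_end su.
have ha : h a = a by rewrite hu ?lexx.
have hb : h b = b by rewrite hu ?lexx ?ab.
rewrite !sn ?plGVK//.
  by rewrite plG_leV plG_geV ua ub.
by rewrite plG_leV plG_geV ha hb.
Qed.

(** [gen1] fixes 3/8 but moves its image 5/8 under [gen0]. *)
Lemma gen_not_commute : [~ gen0 R, gen1 R]%g <> 1%g.
Proof.
move=> /eqP/commgP /(congr1 (fun f : plG => f (3 / 8)));
  rewrite [LHS]plGME [RHS]plGME.
rewrite (@gen1_supp R (3 / 8)); last by left; lra.
rewrite gen0_2; last by lra.
have -> : 3 / 8 + 4^-1 = halve R 4^-1 by rewrite halveE; lra.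
rewrite plGJ gen0_1; last by lra.
by rewrite !halveE; lra.
Qed.

Lemma plG_conjR f g h : ([~ f, g] ^ h = [~ f ^ h, g ^ h])%g.
Proof.
by rewrite !commgEl conjMg conjVg conjJg.
Qed.

Lemma commg_neq1 f g : ([~ f, g]%g <> 1%g) -> forall h, [~ f ^ h,
  g ^ h]%g <> 1%g.
Proof.
move=> fg h; rewrite -plG_conjR.
by move=> /eqP; rewrite conjg_eq1 => /eqP.
Qed.

Theorem inner_of_contraction H a b : is_subgroup H -> (forall h, H h ->
  supp 0 1 h) ->
  dyadic a -> dyadic b -> 0 <= a -> a < b -> b <= 1 ->
  (forall u, supp a b u -> exists2 h, H h & agree a b h u) ->
  (forall x y, 0 < x -> x < y -> y < 1 -> exists t, [/\ H t,
    a < t x & t y < b]) ->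
  forall f, inner f -> H f.
Proof.
move=> sH H01 da db a0 ab b1 lift contr.
have S := supp_subgroup (R := R) a b.
have liftR (n u : plG) : H n -> supp a b n -> supp a b u -> H [~ n,
  u]%g /\ supp a b [~ n, u]%g.
  move=> Hn sn su; split; last exact: subgroupR S sn su.
  have [U HU Uu] := lift _ su.
  by rewrite commgEl -(agreeJ sn su Uu) -commgEl; exact: subgroupR.
(* Lift two non-commuting elements of F_[a, b] to H. The commutator of the lifts is nontrivial
   already on [a, b], and it is inner, so H contracts its support into [a, b]. *)
have [n [Hn sn n1]] : exists n : plG, [/\ H n, supp a b n & n <> 1%g].
  have [th [th0 th1]] := plG_interp (@dyadic0 R) (@dyadic1 R) da db ltr01 ab.
  have su : supp a b (gen0 R ^ th)%g by rewrite -th0 -th1;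
    exact: (suppJ th (@gen0_supp R)).
  have sv : supp a b (gen1 R ^ th)%g.
    by rewrite -th0 -th1; apply: suppJ; apply: suppW (@gen1_supp R) _ _; lra.
  have [U HU Uu] := lift _ su; have [V HV Vv] := lift _ sv.
  have [p [q [dp dq p0 /andP[pq q1] sc]]] := inner_supp (inner_commg (H01 _ HU)
    (H01 _ HV)).
  have [t [Ht atp tqb]] := contr p q p0 pq q1.
  exists ([~ U, V] ^ t)%g; split.
  - by apply: subgroupJ => //; exact: subgroupR.
  - by apply: suppW (suppJ t sc) _ _; exact: ltW.
  move=> /eqP; rewrite conjg_eq1 => /eqP UV1.
  apply: (commg_neq1 gen_not_commute (h := th)); apply: plG_inj => x.
  have [hx|hx] := boolP (a <= x <= b); first by rewrite -(agreeR su sv Uu Vv)//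
    UV1.
  have hx' : x <= a \/ b <= x by move: hx; case: leP => /= ?; case: leP => // ?;
    lra.
  by rewrite (subgroupR S su sv).
have {n Hn sn n1} [n [Hn sn [x nx]]] : exists n : plG, [/\ H n,
  supp a b n & exists x, x < n x].
  have [x xn] : exists x, n x <> x.
    by apply: contrapT => nn; apply: n1; apply: plG_inj => x; apply: contrapT =>
      nx; apply: nn; exists x.
  case: (ltgtP x (n x)) => [xlt|xgt|/esym//].
    by exists n; split => //; exists x.
  by exists n^-1%g; split; [exact: subgroupV|exact: subgroupV S sn|exists x;
    rewrite plG_gtV].
have ax : a < x by rewrite ltNge; apply/negP => xa;
  rewrite (sn x) ?ltxx// in nx; left.
have nxb : n x < b.
  have xb : x < b by rewrite ltNge; apply/negP => bx;
    rewrite (sn x) ?ltxx// in nx; right.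
  by have := @supp_itv R _ _ _ x sn; rewrite ax xb => /(_ isT) /andP[].
have [i di /andP[xi in_]] := dyadic_dense nx.
have [j dj /andP[ij jn]] := dyadic_dense in_.
have jni : j <= n i by apply: ltW; apply: (lt_trans jn); rewrite plG_lt.
have [ph [ph0 ph1]] := plG_interp (@dyadic0 R) (@dyadic1 R) di dj ltr01 ij.
have sph u : supp 0 1 u -> supp i j (u ^ ph)%g.
  by move=> su; rewrite -ph0 -ph1; exact: (suppJ ph su).
have ai : a <= i by apply: ltW; exact: lt_trans ax xi.
have jb : j <= b by apply: ltW; exact: lt_trans jn nxb.
(* H contains the copy on [i, j] of every inner element: modulo [inner_in_commutators] only
   commutators matter, and since j <= n i these are double commutators with [n]. *)
have Hph f : inner f -> H (f ^ ph)%g.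
  apply: (@inner_in_commutators R (fun f => H (f ^ ph)%g)).
    split; first by rewrite conj1g; exact: subgroup1.
    by move=> u v Hu Hv; rewrite conjMg conjVg; exact: (proj2 sH).
  move=> u v su sv; have {}su := sph _ su; have {}sv := sph _ sv.
  have su' := suppW su ai jb; have sv' := suppW sv ai jb.
  rewrite plG_conjR -(double_commutator su sv jni).
  have [Hnu snu] := liftR _ _ Hn sn su'.
  by have [] := liftR _ _ Hnu snu sv'.
(* Contract the support into ]a, b[ by [t], then send it by a lifted [w] onto the image under [ph]
   of [1/4, 3/4], so that pulling back by [ph] gives an inner element. *)
move=> f /inner_supp[p [q [dp dq p0 /andP[pq q1] sf]]].
have [t [Ht atp tqb]] := contr p q p0 pq q1.
have d4 : dyadic (4^-1 : R) by exists 1, 2%N; rewrite mul1r; congr (_^-1); ring.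
have d34 : dyadic (3 / 4 : R) by exists 3, 2%N; congr (_ / _); ring.
have [||||w [sw w1 w2]] := supp_interp da db (plG_dyadic t dp) (plG_dyadic t dq)
  (plG_dyadic ph d4) (plG_dyadic ph d34) atp _ tqb.
- by rewrite plG_lt.
- by apply: le_lt_trans ai _; rewrite -ph0 plG_lt; lra.
- by rewrite plG_lt; lra.
- by apply: lt_le_trans jb; rewrite -ph1 plG_lt; lra.
have [W HW Ww] := lift _ sw.
have HtW : H (t * W)%g by exact: subgroupM.
have := Hph (f ^ (t * W * ph^-1))%g; rewrite -conjgM mulgVK => Hf.
rewrite -[f](conjgK (t * W)%g).
apply: subgroupJ => //; last exact: subgroupV.
apply: Hf; apply: (@supp_inner R 4^-1 (3 / 4)); try lra.
have := suppJ (t * W * ph^-1)%g sf; rewrite !plGME !Ww ?w1 ?w2 ?plGK//.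
  by rewrite (ltW tqb) (le_trans (ltW atp))// plG_le ltW.
by rewrite (ltW atp) (le_trans _ (ltW tqb))// plG_le ltW.
Qed.

End Contraction.

(** * Dynamics of a subgroup agreeing with a model *)

Section Dynamics.
Variable R : realType.
Notation plG := (plG R).
Implicit Types (f g h u v w : plG) (a b c d p x y z : R) (G H : plG -> Prop).

Lemma supp01_itv f x : supp 0 1 f -> 0 < x < 1 -> 0 < f x < 1.
Proof. exact: supp_itv. Qed.

Lemma agreeX f g b n x : (forall z, 0 <= z <= b -> f z = g z) ->
  (forall k, (k < n)%N -> 0 <= ap (g ^+ k) x <= b) ->
    ap (f ^+ n) x = ap (g ^+ n) x.
Proof.
move=> fg; elim: n => // n IH hx; rewrite !plGXS IH ?fg//; first exact: hx.
by move=> k kn; apply: hx; apply: leq_trans kn _.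
Qed.

(* When th maps [0, 1] onto [a, b], the two factors are supported in [a, b] and
   in its image by phi; f^-1 g and g f^-1 induce the two generators on [a, b] if
   f = phi and g = phi * filling phi th nearby. *)
Definition filling (ph th : plG) : plG := (gen0 R ^ th * (gen1 R ^ th) ^ ph)%g.

(** With D n = phi^n d, the contraction criterion is applied on [D 4, D 5]. A pair x < y is
    contracted in four stages: g or its inverse brings y below B, f^-1 brings it below d, h and f
    bring the pair into ]d, D 1[, and f^4 carries it into ]D 4, D 5[. *)
Theorem inner_of_dynamics H f g h (phi th : plG) d B :
  is_subgroup H -> (forall h, H h -> supp 0 1 h) -> H f -> H g -> H h ->
  supp 0 1 phi -> (forall x, 0 < x < 1 -> x < phi x) ->
  dyadic d -> 0 < d < 1 ->
  th 0 = ap (phi ^+ 4) d -> th 1 = ap (phi ^+ 5) d ->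
  ap (phi ^+ 5) d <= B < 1 ->
  (forall x, 0 <= x <= B -> f x = phi x) ->
  (forall x, ap (phi ^+ 3) d <= x <= ap (phi ^+ 5) d ->
    g x = filling phi th (phi x)) ->
  (forall x, B <= x < 1 -> g x < x) \/ (forall x, B <= x < 1 -> x < g x) ->
  (forall x, 0 <= x <= d -> h x = x) ->
  (forall x, d < x <= ap (phi ^+ 2) d -> h x < x) ->
  forall k, inner k -> H k.
Proof.
move=> sH H01 Hf Hg Hh sphi phi_gt dd d01 th0 th1 /andP[bB B1]
  fphi gfill gend hid hlt.
pose D n := ap (phi ^+ n) d.
have DE n : D n.+1 = phi (D n) by rewrite /D plGXS.
have D01 n : 0 < D n < 1.
  by elim: n => [|n IH]; rewrite ?DE; [rewrite /D expg0 plG1E|exact: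
    supp01_itv].
have DS n : D n < D n.+1 by rewrite DE; exact: phi_gt.
have D0 : D 0%N = d by rewrite /D expg0.
have Dlt m n : (m < n)%N -> D m < D n.
  elim: n => // n IH; rewrite ltnS leq_eqVlt => /orP[/eqP->//|/IH mn].
  exact: lt_trans mn (DS n).
have Ddy n : dyadic (D n) by exact: plG_dyadic.
rewrite -/(D 2%N) -/(D 3%N) -/(D 4%N) -/(D 5%N) in th0 th1 bB gfill hlt.
have D01' n : 0 < D n /\ D n < 1 by apply/andP.
have [[D4_0 D4_1] [D5_0 D5_1]] := (D01' 4%N, D01' 5%N).
have D34 := DS 3%N; have D45 := DS 4%N.
have S45 := supp_subgroup (D 4%N) (D 5%N).
have su0 : supp (D 4%N) (D 5%N) (gen0 R ^ th)%g.
  by rewrite -th0 -th1; exact: suppJ (@gen0_supp R).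
have gen1_01 : supp 0 1 (gen1 R) by apply: suppW (@gen1_supp R) _ _; lra.
have su1 : supp (D 4%N) (D 5%N) (gen1 R ^ th)%g.
  by rewrite -th0 -th1; exact: suppJ gen1_01.
have su1' : supp (D 5%N) (D 6%N) ((gen1 R ^ th) ^ phi)%g.
  by rewrite (DE 5%N) (DE 4%N); exact: suppJ.
(* f^-1 sends [D 4, D 5] to [D 3, D 4], where g is phi followed by the filling, whose second factor
   is trivial up to D 5. *)
have lift0 : agree (D 4%N) (D 5%N) (f^-1 * g)%g (gen0 R ^ th)%g.
  move=> x /andP[x4 x5].
  have px3 : D 3%N <= ap phi^-1 x by rewrite plG_geV -DE.
  have px4 : ap phi^-1 x <= D 4%N by rewrite plG_leV -DE.
  have fx : ap f^-1 x = ap phi^-1 x.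
    apply: (@plG_injE R f); rewrite plGVK fphi ?plGVK//.
    by have := D01' 3%N; lra.
  rewrite plGME fx gfill; last by rewrite px3; lra.
  rewrite plGVK plGME; apply: su1'; left.
  by have := @supp_itvc R _ _ _ x su0; rewrite x4 x5 => /(_ isT) /andP[].
(* Here phi lands in [D 5, D 6], where only the second factor of the filling acts, and f^-1 undoes
   the conjugation by phi. *)
have lift1 : agree (D 4%N) (D 5%N) (g * f^-1)%g (gen1 R ^ th)%g.
  move=> x /andP[x4 x5].
  have /andP[v4 v5] : D 4%N <= ap (gen1 R ^ th) x <= D 5%N.
    by apply: supp_itvc su1 _; rewrite x4.
  rewrite plGME gfill; last by rewrite x5; lra.
  rewrite [filling _ _ _]plGME (su0 (phi x)); last by right; rewrite DE plG_le.
  rewrite plGJ -fphi; last by lra.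
  by rewrite plGK.
have lift u : supp (D 4%N) (D 5%N) u -> exists2 h,
  H h & agree (D 4%N) (D 5%N) h u.
  move=> su.
  pose G (y : plG) := supp 0 1 y /\ exists2 h,
    H h & agree (D 4%N) (D 5%N) h (y ^ th)%g.
  have thS (y : plG) : supp 0 1 y -> supp (D 4%N) (D 5%N) (y ^ th)%g.
    by move=> sy; rewrite -th0 -th1; exact: suppJ.
  have gG : gen_closed G.
    split.
    - split; first by split => //; exists 1%g;
        [exact: subgroup1|rewrite conj1g].
      move=> y z [sy [k Hk ky]] [sz [l Hl lz]]; split.
        exact: (proj2 (supp_subgroup 0 1)).
      exists (k * l^-1)%g; first exact: (proj2 sH).
      rewrite conjMg conjVg; apply: agreeM => //; first exact: thS.
      by apply: agreeV => //; exact: thS.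
    - split; first exact: gen0_supp.
      by exists (f^-1 * g)%g => //; apply: subgroupM => //; exact: subgroupV.
    - split; first exact: gen1_01.
      by exists (g * f^-1)%g => //; apply: subgroupM => //; exact: subgroupV.
  have sut : supp 0 1 (u ^ th^-1)%g.
    have := suppJ th^-1%g su; rewrite -th0 -th1.
    by rewrite !plGK.
  by have [_ [k Hk]] := gen_full gG sut; rewrite conjgKV => ku; exists k.
refine (inner_of_contraction sH H01 (Ddy 4%N) (Ddy 5%N) (ltW D4_0) D45 (ltW
  D5_1) lift _).
move=> x y x0 xy y1.
have H_itv s z : H s -> 0 < z < 1 -> 0 < s z < 1.
  by move=> /H01 ss; exact: supp01_itv.
have phiVlt z : 0 < z < 1 -> ap phi^-1 z < z by move=> hz;
  rewrite plG_ltV phi_gt.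
have step1 : exists2 s, H s & s y < B.
  have [gl|gr] := gend.
    case: (plG_drift (f := g) (e := B) (y := y)) => [z hz|n hn];
      first by apply: gl; lra.
    by exists (g ^+ n)%g => //; exact: subgroupX.
  case: (plG_drift (f := g^-1%g) (e := B) (y := y)) => [z hz|n hn].
    by rewrite plG_ltV; apply: gr; lra.
  by exists (g^-1 ^+ n)%g => //; apply: subgroupX => //; exact: subgroupV.
have [s1 Hs1 s1y] := step1.
have /andP[s1x0 s1x1] : 0 < s1 x < 1 by apply: H_itv => //; lra.
have s1xy : s1 x < s1 y by rewrite plG_lt.
have step2 : exists2 s, H s & s (s1 y) < d.
  case: (plG_drift (f := f^-1%g) (e := d) (y := s1 y)) => [z hz|n hn].
    by rewrite plG_ltV fphi ?phi_gt//; lra.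
  by exists (f^-1 ^+ n)%g => //; apply: subgroupX => //; exact: subgroupV.
have [s2 Hs2 s2y] := step2.
have /andP[s2x0 s2x1] : 0 < s2 (s1 x) < 1 by apply: H_itv => //; lra.
have s2xy : s2 (s1 x) < s2 (s1 y) by rewrite plG_lt.
have hd : h d = d by apply: hid; lra.
have squeeze z : z <= D 2%N -> exists n, ap (h ^+ n) z < D 1%N.
  move=> z2; apply: plG_drift => t ht; apply: hlt.
  by have := Dlt 0%N 1%N isT; rewrite D0; lra.
(* Induction on the number of applications of phi taking [z] beyond d. A power of h pulls [t] below
   D 1; while z <= d it fixes [z], and then f brings [z] one application closer while [t] stays
   below D 2. Once z > d it stays so, because h fixes d. *)
have step3 n : forall z t, d < ap (phi ^+ n) z -> 0 < z -> z < t ->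
  t <= D 2%N ->
    exists s, [/\ H s, d < s z & s t < D 1%N].
  elim: n => [|n IH] z t dz z0 zt t2; have [m hm] := squeeze _ t2.
    exists (h ^+ m)%g; split => //; first exact: subgroupX.
    by rewrite -(plG_iter_fix m hd) plG_lt; rewrite expg0 in dz.
  have [zd|dltz] := leP z d; last first.
    exists (h ^+ m)%g; split => //; first exact: subgroupX.
    by rewrite -(plG_iter_fix m hd) plG_lt.
  have hz : ap (h ^+ m) z = z by apply: plG_iter_fix; apply: hid; lra.
  have hzt : z < ap (h ^+ m) t by rewrite -{1}hz plG_lt.
  have D15 := Dlt 1%N 5%N isT.
  have fz : f z = phi z by apply: fphi; have := Dlt 0%N 1%N isT; rewrite D0;
    lra.
  have ft : f (ap (h ^+ m) t) = phi (ap (h ^+ m) t) by apply: fphi; lra.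
  have [||||s [Hs sz st]] := IH (f z) (f (ap (h ^+ m) t)).
  - by rewrite fz -plGXSr.
  - by rewrite fz; apply: (lt_trans z0); apply: phi_gt; lra.
  - by rewrite plG_lt.
  - by rewrite ft (DE 1%N) plG_le ltW.
  exists (h ^+ m * f * s)%g; split.
  - by apply: subgroupM => //; apply: subgroupM => //; exact: subgroupX.
  - by rewrite !plGME hz.
  - by rewrite !plGME.
have [n hn] : exists n, d < ap (phi ^+ n) (s2 (s1 x)).
  case: (plG_drift (f := phi^-1%g) (e := s2 (s1 x)) (y := d)) => [z hz|n hn].
    by apply: phiVlt; lra.
  by exists n; rewrite expVgn plG_ltV in hn.
have [|s3 [Hs3 s3x s3y]] := step3 n _ _ hn s2x0 s2xy.
  by have := Dlt 0%N 2%N isT; rewrite D0; lra.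
exists (s1 * s2 * s3 * f ^+ 4)%g.
have f4 z : d <= z <= D 1%N -> ap (f ^+ 4) z = ap (phi ^+ 4) z.
  move=> /andP[dz z1]; apply: (agreeX fphi) => k k4.
  have h1 : D k <= ap (phi ^+ k) z by rewrite plG_le.
  have h2 : ap (phi ^+ k) z <= D k.+1 by rewrite /D plGXSr plG_le; move: z1;
    rewrite DE D0.
  have h3 : D k.+1 <= D 5%N.
    by apply/ltW/Dlt; rewrite ltnS.
  by have := D01' k; lra.
have tE z : ap (s1 * s2 * s3 * f ^+ 4) z = ap (f ^+ 4) (s3 (s2 (s1 z))) by [].
have s3xy : s3 (s2 (s1 x)) < s3 (s2 (s1 y)) by rewrite plG_lt.
split.
- by do !apply: subgroupM => //; exact: subgroupX.
- rewrite tE f4; last by lra.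
  by rewrite plG_lt.
- rewrite tE f4; last by lra.
  have -> : D 5%N = ap (phi ^+ 4) (D 1%N) by rewrite /D -plGME -expgnDr.
  by rewrite plG_lt.
Qed.

End Dynamics.

(** * Prescribing maps up to conjugacy *)

Section Prescription.
Variable R : realType.
Notation plG := (plG R).
Implicit Types (f g h u v w phi psi th : plG) (a b c d p x y z : R) (G H : plG
  -> Prop).

(** The conjugate sends phi^n y to phi^n (f y), and for n large every phi^n y in [0, B] has y <= e,
    where f is phi. *)
Lemma conj_prescribed f phi (e B : R) : (forall x, 0 <= x <= e ->
  f x = phi x) -> phi 0 = 0 ->
  (forall x, e <= x <= B -> x < phi x) ->
  exists n, forall x, 0 <= x <= B -> ap (f ^ (phi ^+ n)) x = phi x.
Proof.
move=> fphi phi0 phi_gt.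
have [|n hn] := @plG_drift R phi^-1%g e B; first by move=> x /phi_gt;
  rewrite plG_ltV.
exists n => x /andP[x0 xB]; rewrite expVgn in hn.
have [y xE] : exists y, x = ap (phi ^+ n) y by exists (ap (phi ^+ n)^-1 x);
  rewrite plGVK.
rewrite {}xE in x0 xB *; rewrite plGJ fphi; first by rewrite -plGXSr plGXS.
apply/andP; split; first by rewrite -(plG_le (phi ^+ n)%g) (plG_iter_fix n
  phi0).
by rewrite -(plG_le (phi ^+ n)%g); apply: (le_trans xB); rewrite -plG_leV ltW.
Qed.

Lemma filling_supp phi th n d : th 0 = ap (phi ^+ n) d ->
  th 1 = ap (phi ^+ n.+1) d ->
  supp (ap (phi ^+ n) d) (ap (phi ^+ n.+1) d) (gen0 R ^ th)%g /\
  supp (ap (phi ^+ n.+1) d) (ap (phi ^+ n.+2) d) ((gen1 R ^ th) ^ phi)%g.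
Proof.
move=> th0 th1; split.
  by rewrite -th0 -th1; exact: suppJ (@gen0_supp R).
rewrite (plGXS phi n.+1) (plGXS phi n) -{1}th0 -plGXS -th1.
by apply: suppJ; apply: suppJ; apply: suppW (@gen1_supp R) _ _; lra.
Qed.

(** The filling preserves two consecutive fundamental intervals of phi, while phi advances by a
    whole one, so the filling cannot bring phi x back to x. *)
Lemma filling_gt phi th n d x : th 0 = ap (phi ^+ n) d ->
  th 1 = ap (phi ^+ n.+1) d ->
  x < phi x -> x < filling phi th (phi x).
Proof.
move=> th0 th1 xphi; have [s0 s1] := filling_supp th0 th1;
  rewrite [filling _ _ _]plGME.
have [x5|x5] := leP (phi x) (ap (phi ^+ n.+1) d); last first.
  rewrite s0; last by right; exact: ltW.
  have x5' : x < ap (phi ^+ n.+2) d -> ap (phi ^+ n.+1) d < ap ((gen1 R ^ th) ^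
    phi) (phi x).
    by move=> ?; rewrite -{1}(supp_end s1).1 plG_lt.
  have [xn|xn] := leP x (ap (phi ^+ n.+1) d); last by rewrite s1; [|right;
    rewrite plGXS plG_le ltW].
  apply: (le_lt_trans xn); rewrite -{1}(supp_end s1).1 plG_lt //.
have x4 : x <= ap (phi ^+ n) d by rewrite -(plG_le phi) -plGXS.
rewrite s1; last by left; rewrite -(supp_end s0).2 plG_le.
have [xlt|xge] := leP (phi x) (ap (phi ^+ n) d); first by rewrite s0//; left.
by apply: (le_lt_trans x4); rewrite -{1}(supp_end s0).1 plG_lt.
Qed.

Lemma conj_germ s q f g (k l : int) : germ s q f k -> germ s q g l ->
  germ s q (f ^ g)%g k.
Proof.
move=> fk gl; rewrite conjgE (_ : k = - l + (k + l)); last by lia.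
by apply: germM (germV gl) (germM fk gl).
Qed.

(** A slope at 1 different from 1 excludes other fixed points nearby. *)
Lemma germ_sign g (s : int) : s != 0 -> germ (-1) 1 g s -> exists2 z, z < 1 &
  (forall x, z <= x < 1 -> g x < x) \/ (forall x, z <= x < 1 -> x < g x).
Proof.
move=> s0 [e e0 ge]; exists (1 - e); first by lra.
have gE x : 1 - e <= x < 1 -> g x = 1 - 2 ^ s * (1 - x).
  move=> hx; have := ge (1 - x); have -> : 1 + -1 * (1 - x) = x by ring.
  by move=> ->; [ring|lra].
have [sgt|slt] : 0 < s \/ 0 < - s by lia.
  left => x hx; rewrite gE//; have := pow2_ge2 R sgt; set q := 2 ^ s => q2.
  by have : 1 * (1 - x) < q * (1 - x); [rewrite ltr_pM2r; lra|lra].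
right => x hx; rewrite gE//; have := pow2_ge2 R slt.
rewrite -invr_expz; set q := 2 ^ s => q2.
have q0 : 0 < q by exact: pow2_gt0.
have q1 : q < 1 by rewrite -invf_gt1//; lra.
by have : q * (1 - x) < 1 * (1 - x); [rewrite ltr_pM2r; lra|lra].
Qed.

(** Conjugating by powers of phi and psi makes f and g follow their models on long intervals. A
    further conjugation by [tau], acting only above psi (phi^5 d), moves the start of the end region
    where g has no fixed point down to B without changing g on [0, phi^5 d]. The last hypothesis
    asks for the element h of the dynamics, to be built from the models alone. *)
Lemma conj_full_of_model f g phi psi th d (e e' : R) (s : int) :
  supp 0 1 f -> supp 0 1 g -> supp 0 1 phi -> supp 0 1 psi ->
  (forall x, 0 < x < 1 -> x < phi x) -> 0 < e ->
  (forall x, 0 <= x <= e -> f x = phi x) ->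
  (forall x, 0 <= x <= e' -> g x = psi x) ->
  (forall x, e' <= x < 1 -> x < psi x) ->
  s != 0 -> germ (-1) 1 g s ->
  dyadic d -> 0 < d < 1 -> th 0 = ap (phi ^+ 4) d -> th 1 = ap (phi ^+ 5) d ->
  (forall x, ap (phi ^+ 3) d <= x <= ap (phi ^+ 5) d ->
    psi x = filling phi th (phi x)) ->
  (forall H (f' g' : plG), is_subgroup H -> H f' -> H g' ->
    (forall x, 0 <= x <= ap (phi ^+ 5) d -> f' x = phi x) ->
    (forall x, 0 <= x <= ap (phi ^+ 5) d -> g' x = psi x) ->
    exists h, [/\ H h, forall x, 0 <= x <= d -> h x = x &
      forall x, d < x <= ap (phi ^+ 2) d -> h x < x]) ->
  exists s1 s2 : plG, [/\ supp 0 1 s1, supp 0 1 s2 &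
    forall H, is_subgroup H -> (forall h, H h -> supp 0 1 h) ->
    H (f ^ s1)%g -> H (g ^ s2)%g -> forall k, inner k -> H k].
Proof.
move=> sf sg sphi spsi phi_gt e0 fphi gpsi psi_gt s0 germg dd d01 th0 th1
  psifill words.
have S01 := @supp_subgroup R 0 1.
pose D n := ap (phi ^+ n) d.
have DE n : D n.+1 = phi (D n) by rewrite /D plGXS.
have D01 n : 0 < D n < 1.
  by elim: n => [|n IH]; rewrite ?DE; [rewrite /D expg0 plG1E|exact:
    supp01_itv].
have DS n : D n < D n.+1 by rewrite DE; exact: phi_gt.
have D5_01 := D01 5%N; have D4 := DS 4%N; have D3 := DS 3%N.
have psiD5 : D 5%N < psi (D 5%N).
  rewrite psifill; last by rewrite -/(D 3%N) -/(D 5%N) lexx; lra.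
  by apply: filling_gt th0 th1 _; exact: phi_gt.
have /andP[c0 c1] : 0 < psi (D 5%N) < 1 by exact: supp01_itv.
have [phi0 _] := supp_end sphi; have [psi0 _] := supp_end spsi.
have [n2 g1E] := conj_prescribed gpsi psi0 (B := psi (D 5%N))
  (fun x hx => psi_gt x (ltac:(lra) : e' <= x < 1)).
set g1 := (g ^ (psi ^+ n2))%g in g1E.
have spsin : supp 0 1 (psi ^+ n2)%g by exact: subgroupX S01 spsi.
have germg1 : germ (-1) 1 g1 s.
  by have [l hl] := germ1_ex (supp_end spsin).2; exact: conj_germ germg hl.
have [z z1 sgn] := germ_sign s0 germg1.
have dc : dyadic (psi (D 5%N)) by do 2!apply: plG_dyadic.
have [x dx /andP[]] := @dyadic_dense R (Num.max z (psi (D 5%N))) 1 ltac:(by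
  rewrite gt_max z1).
rewrite gt_max => /andP[zx cx] x1.
have [y dy /andP[xy y1]] := dyadic_dense x1.
have [B dB /andP[cB B1]] := dyadic_dense c1.
have [C dC /andP[BC C1]] := dyadic_dense B1.
(* Only tau x = B matters; [y] and [C] merely fill the second interpolation point. *)
have [tau [stau taux _]] := supp_interp dc (@dyadic1 R) dx dy dB dC cx xy y1 cB
  BC C1.
have [n1 f1E] := conj_prescribed fphi phi0 (B := B)
  (fun x hx => phi_gt x (ltac:(lra) : 0 < x < 1)).
have stau01 : supp 0 1 tau by apply: suppW stau _ _; lra.
exists (phi ^+ n1)%g, (psi ^+ n2 * tau)%g; split.
- exact: subgroupX S01 sphi.
- exact: subgroupM S01 spsin stau01.
move=> H sH H01 Hf Hg.
rewrite conjgM -/g1 in Hg.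
have g2E t : 0 <= t <= D 5%N -> ap (g1 ^ tau) t = psi t.
  move=> ht; have -> : t = tau t by rewrite stau//; left; lra.
  have ht' : 0 <= t <= psi (D 5%N) by lra.
  rewrite plGJ g1E// (stau t); last by left; lra.
  by apply: stau; left; rewrite plG_le; case/andP: ht.
have f2E t : 0 <= t <= D 5%N -> ap (f ^ (phi ^+ n1)) t = phi t.
  by move=> ht; apply: f1E; lra.
have [h [Hh hid hlt]] := words H _ _ sH Hf Hg f2E g2E.
have sgnB : (forall x, B <= x < 1 -> ap (g1 ^ tau) x < x) \/
    (forall x, B <= x < 1 -> x < ap (g1 ^ tau) x).
  have tau1 : tau 1 = 1 by apply: stau; right.
  have zz t : B <= t < 1 -> z <= ap tau^-1 t < 1.
    move=> /andP[Bt t1]; rewrite plG_geV plG_ltV tau1 t1 andbT.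
    by apply: le_trans Bt; rewrite -taux plG_le ltW.
  case: sgn => sgn; [left|right] => t /zz /sgn.
    by rewrite plGJE -(plG_lt tau) plGVK.
  by rewrite plGJE -(plG_lt tau) plGVK.
apply: (inner_of_dynamics (B := B) sH H01 Hf Hg Hh sphi phi_gt dd d01 th0 th1)
  => //.
- by rewrite -/(D 5%N) B1 andbT; lra.
- move=> t ht; rewrite g2E ?psifill//.
  by have := D01 3%N; rewrite -/(D 3%N) -/(D 5%N) in ht; lra.
Qed.

End Prescription.

(** * Model with both maps moving points near 0 *)

Section TwoConjugates.
Variable R : realType.
Notation plG := (plG R).
Implicit Types (f g h u v w phi psi th : plG) (a b c d p x y z : R) (G H : plG
  -> Prop).

Lemma gen0_gt x : 0 < x < 1 -> x < gen0 R x.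
Proof.
move=> hx; have [x4|x4] := leP x 4^-1; first by rewrite gen0_1; lra.
have [x2|x2] := leP x 2^-1; first by rewrite gen0_2; lra.
by rewrite gen0_3; lra.
Qed.

Lemma gen0X_gt n x : 0 < x < 1 -> x < ap (gen0 R ^+ n.+1) x.
Proof.
elim: n => [|n IH] hx; first by rewrite expg1; exact: gen0_gt.
rewrite plGXS; apply: (lt_trans (IH hx)); apply: gen0_gt.
exact: supp_itv (subgroupX _ (supp_subgroup 0 1) (@gen0_supp R)) hx.
Qed.

(** Three pieces: psi1 up to m, phi followed by the filling from psi1 m on, and between them an
    interpolation. The latter has values at least psi1 m, hence no fixed point before psi1 m. *)
Lemma extend_model phi th psi1 d m : supp 0 1 phi -> (forall x, 0 < x < 1 ->
  x < phi x) ->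
  0 < d < 1 -> th 0 = ap (phi ^+ 4) d -> th 1 = ap (phi ^+ 5) d ->
  dyadic m -> 0 < m -> m < psi1 m <= ap (phi ^+ 3) d -> (forall x, x <= 0 ->
    psi1 x = x) ->
  exists psi, [/\ supp 0 1 psi, forall x, x <= m -> psi x = psi1 x,
    forall x, psi1 m <= x -> psi x = filling phi th (phi x) &
    forall x, m <= x < 1 -> x < psi x].
Proof.
move=> sphi phi_gt d01 th0 th1 dm m0 /andP[mz z3] psi10.
have S01 := @supp_subgroup R 0 1.
have D01 n : 0 < ap (phi ^+ n) d < 1.
  by apply: supp01_itv d01; exact: subgroupX S01 sphi.
have D3 := D01 3%N; have D4 := D01 4%N; have D5 := D01 5%N; have D6 := D01 6%N.
have [s1 s2] := filling_supp th0 th1.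
have sfill : supp 0 1 (phi * filling phi th)%g.
  apply: (subgroupM S01) => //; apply: (subgroupM S01).
    by apply: suppW s1 _ _; lra.
  by apply: suppW s2 _ _; lra.
have fill_gt x : 0 < x < 1 -> x < ap (phi * filling phi th) x.
  by move=> hx; apply: filling_gt th0 th1 _; exact: phi_gt.
have dz : dyadic (psi1 m) by exact: plG_dyadic.
have zfill : psi1 m < ap (phi * filling phi th) (psi1 m) by apply: fill_gt; lra.
have [t [tm tz]] := plG_interp dm dz dz (plG_dyadic (phi * filling phi th)%g dz)
  mz zfill.
have [e1 [e1L e1R]] := plG_paste dz tz.
have [|e2 [e2L e2R]] := @plG_paste R psi1 e1 m dm;
  first by rewrite e1L ?tm// ltW.
exists e2; split.
- move=> x [x0|x1]; first by rewrite e2L ?psi10//; lra.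
  by rewrite e2R ?e1R ?sfill//; [right|lra|lra].
- exact: e2L.
- by move=> x zx; rewrite e2R ?e1R//; lra.
move=> x /andP[mx x1]; have [zx|xz] := leP (psi1 m) x.
  by rewrite e2R ?e1R//; apply: fill_gt; lra.
rewrite e2R// e1L ?(ltW xz)//; apply: (lt_le_trans xz).
by rewrite -[leLHS]tm plG_le.
Qed.

(* The quantification over H stands for the subgroup generated by f^s1 and
   g^s2. *)
Definition conj_full f g := exists s1 s2 : plG, [/\ supp 0 1 s1, supp 0 1 s2 &
  forall H, is_subgroup H -> (forall h, H h -> supp 0 1 h) ->
  H (f ^ s1)%g -> H (g ^ s2)%g -> forall k, inner k -> H k].

Lemma pusher (p : int) : 0 < p -> exists phi (e : R),
  [/\ supp 0 1 phi, forall x, 0 < x < 1 -> x < phi x, 0 < e &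
      forall t, 0 <= t <= e -> phi t = 2 ^ p * t].
Proof.
move=> p0; exists (gen0 R ^+ `|p|)%g.
have [e e0 phiE] : germ 1 0 (gen0 R ^+ `|p|)%g p.
  by have := germX `|p| (@germ_gen0 R); have -> : 1 *+ `|p| = p by lia.
exists e; split => //.
- exact: subgroupX (supp_subgroup 0 1) (@gen0_supp R).
- move=> x; have [n ->] : exists n, `|p|%N = n.+1 by exists `|p|.-1; lia.
  exact: gen0X_gt.
by move=> t /phiE; rewrite !add0r !mul1r.
Qed.

(** The model of g near 0, bent so that its commutator with a multiplication can be computed in
    [commg_push]. *)
Lemma bend_ex (k : int) d : 0 < k -> dyadic d -> 0 < d -> exists psi (r : R),
  [/\ 0 < r, 2 ^ k * r = d, forall x, x <= 0 -> psi x = x,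
      forall x, 0 <= x <= r -> psi x = 2 ^ k * x &
      forall x, r <= x -> psi x = x + (d - r)].
Proof.
move=> k0 dd d0; pose r := 2 ^ (- k) * d.
have Kr : 2 ^ k * r = d by rewrite /r mulrA -expfzDr ?pnatr_eq0// addrN expr0z
  mul1r.
have dr : dyadic r by exact: dyadicM_pow2.
have r0 : 0 < r by rewrite mulr_gt0 ?pow2_gt0.
have [f1 f1E] := plG_affine k (@dyadic0 R).
have [f2 f2E] := plG_affine 0 (dyadicB dd dr).
have [|e1 [e1L e1R]] := @plG_paste R f1 f2 r dr.
  by rewrite f1E f2E Kr expr0z; ring.
have [|psi [psiL psiR]] := @plG_paste R 1%g e1 0 (@dyadic0 R).
  by rewrite e1L ?(ltW r0)// f1E mulr0 addr0.
exists psi, r; split => //.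
- by move=> x /andP[x0 xr]; rewrite psiR// e1L// f1E addr0.
- move=> x rx; rewrite psiR ?e1R// ?f2E ?expr0z ?mul1r//.
  exact: le_trans (ltW r0) rx.
Qed.

(** While g is linear it commutes with multiplication by P. Once P u > r, g is only a translation at
    P u, so g (P u) < P g(u). *)
Lemma commg_push f g (P K r m : R) : 2 <= P -> 2 <= K -> 0 < r -> K * r <= m ->
  (forall x, 0 <= x <= m -> f x = P * x) ->
  (forall x, 0 <= x <= r -> g x = K * x) ->
  (forall x, r <= x <= m -> g x = x + (K * r - r)) ->
  (forall x, 0 <= x <= K * r -> ap [~ f, g] x = x) /\
  (forall x, K * r < x <= m -> ap [~ f, g] x < x).
Proof.
move=> P2 K2 r0 rm fE gE1 gE2.
have r2 : 2 * r <= K * r by rewrite ler_pM2r.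
(* With u = g^-1 (f^-1 x), the point x is P g(u) and its image under f^-1 g^-1 f g is g (P u). *)
have key x : 0 <= x <= m -> exists u : R, [/\ 0 <= u, u <= m, P * u <= m,
    x = P * g u & ap [~ f, g] x = g (P * u)].
  move=> /andP[x0 xm]; pose w := ap f^-1 x; pose u := ap g^-1 w.
  have xE : x = f w by rewrite /w plGVK.
  have wE : w = g u by rewrite /u plGVK.
  have m0 : 0 < m by lra.
  have m2 : 2 * m <= P * m by rewrite ler_pM2r.
  have w0 : 0 <= w by rewrite plG_geV fE ?mulr0// lexx ltW.
  have wm : w <= m by rewrite plG_leV fE ?lexx ?(ltW m0)//; lra.
  have xw : x = P * w by rewrite xE fE ?w0.
  have u0 : 0 <= u by rewrite plG_geV gE1 ?mulr0// lexx ltW.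
  have um : u <= m.
    rewrite plG_leV gE2; last by rewrite lexx andbT; lra.
    by clear -wm r2 r0; lra.
  have uw : u <= w.
    rewrite wE; have [ur|ru] := leP u r.
      by rewrite gE1 ?u0// ler_peMl//; clear -K2; lra.
    by rewrite gE2 ?(ltW ru)//; clear -r2 r0; lra.
  have Puw : P * u <= P * w by rewrite ler_pM2l//; clear -P2; lra.
  have Pu0 : 0 <= P * u by rewrite mulr_ge0//; clear -P2; lra.
  exists u; split => //; first by rewrite -xw in Puw; exact: le_trans Puw xm.
    by rewrite -wE.
  by rewrite commgEl conjgE !plGME -/w -/u fE ?u0.
have low (u : R) : 0 <= u -> P * u <= r -> g (P * u) = P * g u /\ P * g u <= K *
  r.
  move=> u0 Pur; have Pu0 : 0 <= P * u by rewrite mulr_ge0//; lra.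
  have u2 : 2 * u <= P * u by rewrite ler_wpM2r.
  rewrite !gE1 ?Pu0 ?u0//; last by lra.
  rewrite [P * (K * u)]mulrCA; split => //.
  by rewrite ler_pM2l//; lra.
have high (u : R) : 0 <= u -> u <= m -> P * u <= m -> r < P * u ->
    g (P * u) < P * g u /\ K * r < P * g u.
  move=> u0 um Pum rPu.
  have u2 : 2 * u <= P * u by rewrite ler_wpM2r.
  rewrite gE2 ?(ltW rPu)//; have [ur|ru] := leP u r.
    rewrite gE1 ?u0// [P * (K * u)]mulrCA.
    have KPu : K * r < K * (P * u) by rewrite ltr_pM2l//; lra.
    have : (K - 1) * r < (K - 1) * (P * u) by rewrite ltr_pM2l//; lra.
    by rewrite !mulrBl !mul1r; split; lra.
  rewrite gE2 ?(ltW ru)// mulrDr.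
  have : 2 * (K * r - r) <= P * (K * r - r) by rewrite ler_pM2r//; lra.
  by split; lra.
split=> x hx.
  have [|u [u0 um Pum xE ->]] := key x; first by clear -hx rm; lra.
  have [Pu|Pu] := leP (P * u) r; first by rewrite (low u u0 Pu).1.
  by have := (high u u0 um Pum Pu).2; rewrite -xE; clear -hx; lra.
have [|u [u0 um Pum xE ->]] := key x; first by clear -hx rm r2 r0; lra.
have [Pu|Pu] := leP (P * u) r; last by rewrite [ltRHS]xE; have [] :=
  high u u0 um Pum Pu.
by have := (low u u0 Pu).2; rewrite -xE; clear -hx; lra.
Qed.

Lemma conj_full_left f g (p k s : int) : supp 0 1 f -> supp 0 1 g ->
  0 < p -> germ 1 0 f p -> 0 < k -> germ 1 0 g k -> s != 0 -> germ (-1) 1 g s ->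
  conj_full f g.
Proof.
move=> sf sg p0 [ef ef0 fE] k0 [eg eg0 gE] s0 germs.
have [phi [e [sphi phi_gt e0 phiE]]] := pusher p0.
have P2 := pow2_ge2 R p0; have K2 := pow2_ge2 R k0.
have [phi0 phi1] := supp_end sphi.
have {}fE t : 0 <= t <= ef -> f t = 2 ^ p * t.
  by move=> /fE; rewrite !add0r !mul1r.
have {}gE t : 0 <= t <= eg -> g t = 2 ^ k * t.
  by move=> /gE; rewrite !add0r !mul1r.
have phi50 : ap (phi ^+ 5) 0 = 0 by exact: plG_iter_fix.
(* Such a d makes phi a multiplication by 2^p on all of [0, phi^5 d]. *)
have [d dd /andP[d0]] : exists2 d, dyadic d & 0 < d < Num.min (ap (phi ^+ 5)^-1
  e) 1.
  by apply: dyadic_dense; rewrite lt_min ltr01 plG_gtV phi50 e0.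
rewrite lt_min plG_gtV => /andP[d5 d1].
pose D n := ap (phi ^+ n) d.
have D0 : D 0%N = d by rewrite /D expg0.
have DE n : D n.+1 = phi (D n) by rewrite /D plGXS.
have D01 n : 0 < D n < 1.
  by elim: n => [|n IH]; rewrite ?DE ?D0 ?d0//; exact: supp01_itv.
have DS n : D n < D n.+1 by rewrite DE; exact: phi_gt.
have D5 : d <= D 2%N /\ D 2%N < D 5%N.
  have := DS 0%N; have := DS 1%N; have := DS 2%N; have := DS 3%N; have :=
    DS 4%N.
  by clear -D0; rewrite D0; split; lra.
have [dD2 D25] := D5.
have {}d5 : D 5%N < e by [].
have Ddy n : dyadic (D n) by exact: plG_dyadic.
have [th [th0 th1]] :=
  plG_interp (@dyadic0 R) (@dyadic1 R) (Ddy 4%N) (Ddy 5%N) ltr01 (DS 4%N).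
have [psi1 [r [r0 Kr psi1L psi1E1 psi1E2]]] := bend_ex k0 dd d0.
have rd : 2 * r <= d by rewrite -Kr ler_pM2r.
have zE : psi1 (D 2%N) = D 2%N + (d - r) by apply: psi1E2; clear -rd r0 dD2;
  lra.
(* D 3 is at least twice D 2, hence at least D 2 + d. *)
have z3 : psi1 (D 2%N) <= D 3%N.
  have : 2 * D 2%N <= 2 ^ p * D 2%N by rewrite ler_pM2r//; clear -dD2 d0; lra.
  rewrite zE (DE 2%N) phiE; last by clear -dD2 d0 D25 d5; lra.
  by clear -rd r0 dD2; lra.
have [|||psi [spsi psiE psifill psi_gt]] := extend_model (psi1 := psi1) (m :=
  D 2%N)
  sphi phi_gt (D01 0%N) th0 th1 (Ddy 2%N).
- by clear -dD2 d0; lra.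
- by rewrite z3 andbT zE; clear -rd r0; lra.
- exact: psi1L.
have psi_gt' x : 0 < x < 1 -> x < psi x.
  move=> /andP[x0 x1]; have [xm|mx] := leP x (D 2%N); last by apply: psi_gt;
    rewrite (ltW mx).
  rewrite psiE//; have [xr|rx] := leP x r.
    by rewrite psi1E1 ?(ltW x0)// ltr_pMl//; clear -K2; lra.
  by rewrite psi1E2 ?(ltW rx)//; clear -rd r0; lra.
have min0 a b : 0 < a -> 0 < b -> exists2 c, 0 < c & c <= a /\ c <= b.
  move=> a0 b0; exists (Num.min a b); first by rewrite lt_min a0.
  by rewrite !ge_min !lexx orbT.
have [e' e'0 [e'f e'e]] := min0 _ _ ef0 e0.
have [e'' e''0 [e''g e''r]] := min0 _ _ eg0 r0.
apply: (@conj_full_of_model R f g phi psi th d e' e'' s) => //.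
- move=> x /andP[x0 xe]; rewrite fE ?phiE// x0; exact: le_trans xe _.
- move=> x /andP[x0 xe].
  rewrite gE ?psiE ?psi1E1// ?x0 ?(le_trans xe)//.
  by clear -e''r rd d0 dD2 r0; lra.
- by move=> x /andP[ex x1]; apply: psi_gt'; rewrite x1 andbT (lt_le_trans e''0).
- by rewrite d0.
- by move=> x /andP[x3 x5]; apply: psifill; exact: le_trans z3 x3.
move=> H f' g' sH Hf' Hg' fphi gpsi; rewrite -/(D 5%N) in fphi gpsi;
  rewrite -/(D 2%N).
have low5 x : x <= D 2%N -> x <= D 5%N by move=> /le_trans; apply; exact: ltW.
have [||||h1 h2] := @commg_push f' g' _ (2 ^ k) r (D 2%N) P2 K2 r0.
- by rewrite Kr.
- move=> x /andP[x0 xm]; rewrite fphi ?phiE ?x0 ?low5//.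
  exact: le_trans (low5 _ xm) (ltW d5).
- move=> x /andP[x0 xr]; have xm : x <= D 2%N.
    by apply: (le_trans xr); clear -rd r0 dD2; lra.
  by rewrite gpsi ?psiE ?psi1E1 ?x0 ?low5.
- move=> x /andP[rx xm]; rewrite gpsi ?psiE ?psi1E2 ?Kr// ?low5// ?andbT.
  exact: le_trans (ltW r0) rx.
rewrite Kr in h1 h2.
by exists [~ f', g']%g; split => //; exact: subgroupR.
Qed.

End TwoConjugates.

(** * Model with one map trivial near 0 *)

Section TwoConjugatesInner.
Variable R : realType.
Notation plG := (plG R).
Implicit Types (f g h u v w phi psi th : plG) (a b c d p x y z : R) (G H : plG
  -> Prop).

Lemma conj_full_inner f g q (p k s : int) : supp 0 1 f -> supp 0 1 g ->
  0 < p -> germ 1 0 f p -> dyadic q -> 0 < q < 1 -> (forall x, x <= q ->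
    g x = x) ->
  0 < k -> germ 1 q g k -> s != 0 -> germ (-1) 1 g s ->
  conj_full f g.
Proof.
move=> sf sg p0 [ef ef0 fE] dq q01 gq k0 [eg eg0 gE] s0 germs.
have [phi [e [sphi phi_gt e0 phiE]]] := pusher R p0.
have {}fE t : 0 <= t <= ef -> f t = 2 ^ p * t.
  by move=> /fE; rewrite !add0r !mul1r.
have K2 := pow2_ge2 R k0.
pose D n := ap (phi ^+ n) q.
have D0 : D 0%N = q by rewrite /D expg0.
have DE n : D n.+1 = phi (D n) by rewrite /D plGXS.
have D01 n : 0 < D n < 1.
  by elim: n => [|n IH]; rewrite ?DE ?D0//; exact: supp01_itv.
have DS n : D n < D n.+1 by rewrite DE; exact: phi_gt.
have [D1 D25] : q < D 1%N <= D 3%N /\ q < D 2%N < D 5%N.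
  have := DS 0%N; have := DS 1%N; have := DS 2%N; have := DS 3%N; have :=
    DS 4%N.
  by clear -D0; rewrite D0; split; lra.
have h5 := D01 5%N.
have Ddy n : dyadic (D n) by exact: plG_dyadic.
have [th [th0 th1]] := plG_interp (@dyadic0 R) (@dyadic1 R) (Ddy 4%N) (Ddy 5%N)
  ltr01 (DS 4%N).
(* Then psi1 sends q + r to D 1, below the bound D 3 of [extend_model]. *)
pose r := 2 ^ (- k) * (D 1%N - q).
have dr : dyadic r by apply: dyadicM_pow2; exact: dyadicB.
have Kr : 2 ^ k * r = D 1%N - q.
  by rewrite /r mulrA -expfzDr ?pnatr_eq0// addrN expr0z mul1r.
have r0 : 0 < r by rewrite mulr_gt0 ?pow2_gt0// subr_gt0; case/andP: D1.
have rd : 2 * r <= D 1%N - q by rewrite -Kr ler_pM2r.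
have [f1 f1E] := plG_affine k (dyadicB dq (dyadicM_pow2 k dq)).
have [|psi1 [psi1L psi1R]] := @plG_paste R 1%g f1 q dq.
  by rewrite f1E plG1E; ring.
have psi1E t : 0 <= t -> psi1 (q + t) = q + 2 ^ k * t.
  by move=> t0; rewrite psi1R ?f1E; [ring|lra].
have mE : psi1 (q + r) = D 1%N by rewrite psi1E ?(ltW r0)// Kr; ring.
have [||||psi [spsi psiE psifill psi_gt]] := extend_model (psi1 := psi1) (m :=
  q + r) sphi phi_gt
  q01 th0 th1.
- exact: dyadicD.
- by lra.
- by rewrite mE -/(D 3%N); lra.
- by move=> x x0; rewrite psi1L ?plG1E//; lra.
have psi_gt' x : q < x < 1 -> x < psi x.
  move=> /andP[qx x1]; have [xm|mx] := leP x (q + r); last first.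
    by apply: psi_gt; rewrite ltW.
  have -> : x = q + (x - q) by ring.
  rewrite psiE ?psi1E; [|lra|lra]; rewrite ltrD2l.
  by have : 2 * (x - q) <= 2 ^ k * (x - q); [rewrite ler_pM2r//; lra|lra].
have min0 a b : 0 < a -> 0 < b -> exists2 c, 0 < c & c <= a /\ c <= b.
  move=> a0 b0; exists (Num.min a b); first by rewrite lt_min a0.
  by rewrite !ge_min !lexx orbT.
have [e' e'0 [e'f e'e]] := min0 _ _ ef0 e0.
have [e'' e''0 [e''g e''r]] := min0 _ _ eg0 r0.
apply: (@conj_full_of_model R f g phi psi th q e' (q + e'') s) => //.
- by move=> x hx; rewrite fE ?phiE//; lra.
- move=> x hx; have [xq|qx] := leP x q.
    by rewrite gq// psiE ?psi1L//; lra.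
  have -> : x = q + (x - q) by ring.
  rewrite psiE ?psi1E; [|lra|lra].
  by have := gE (x - q); rewrite !mul1r; apply; lra.
- by move=> x hx; apply: psi_gt'; lra.
- move=> x hx; apply: psifill; rewrite -/(D 3%N) in hx; lra.
move=> H f' g' sH Hf' Hg' fphi gpsi; rewrite -/(D 5%N) in fphi gpsi;
  rewrite -/(D 2%N).
clear -sH Hg' gpsi q01 psi_gt' D1 D25 h5 psiE psi1L r0.
(* The model of g fixes [0, q] and pushes the points of ]q, 1[ to the right, so its inverse is the
   required h, with d = q. *)
exists g'^-1%g; split; first exact: subgroupV.
- move=> x hx; apply: plG_eqV; rewrite gpsi ?psiE ?psi1L//; lra.
- by move=> x hx; rewrite plG_ltV gpsi ?psi_gt'//; lra.
Qed.

(** The map can leave the identity only at [a] or at a gluing point, hence at a dyadic point, as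
    [conj_full_inner] requires. *)
Lemma first_break (g : R -> R) : pl2 g -> forall a, dyadic a -> g a = a ->
  (forall x, a <= x -> g x = x) \/
  exists q (k : int) (e : R), [/\ dyadic q, a <= q, forall x, a <= x <= q ->
    g x = x,
    k != 0 & 0 < e /\ forall x, q <= x <= q + e -> g x = q + 2 ^ k * (x - q)].
Proof.
elim=> [k d dd|{}g h p dp gh _ IHg _ IHh] a da ga.
  have [k0|k0] := eqVneq k 0.
    by left => x ax; move: ga; rewrite k0 expr0z !mul1r => ?; lra.
  right; exists a, k, 1; split => //.
    by move=> x hx; have -> : x = a by lra.
  split => // x hx; have -> : d = a - 2 ^ k * a by rewrite -{1}ga; ring.
  by ring.
have [pa|ap] := leP p a.
  rewrite (pasteR gh)// in ga.
  have [hid|[q [k [e [dq aq hq k0 [e0 hk]]]]]] := IHh _ da ga.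
    by left => x ax; rewrite (pasteR gh) ?hid//; lra.
  right; exists q, k, e; split => //.
    by move=> x hx; rewrite (pasteR gh) ?hq//; lra.
  by split => // x hx; rewrite (pasteR gh) ?hk//; lra.
rewrite pasteL ?(ltW ap)// in ga.
(* If the left piece is the identity up to p, the search goes on from p in the right piece. *)
have gid_p : (forall x, a <= x <= p -> g x = x) ->
  (forall x, a <= x -> paste p g h x = x) \/
  exists q (k : int) (e : R), [/\ dyadic q, a <= q, forall x, a <= x <= q ->
    paste p g h x = x,
    k != 0 & 0 < e /\ forall x, q <= x <= q + e ->
      paste p g h x = q + 2 ^ k * (x - q)].
  move=> gid; have hp : h p = p by rewrite -gh gid// lexx ltW.
  have [hid|[q [k [e [dq pq hq k0 [e0 hk]]]]]] := IHh _ dp hp.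
    left => x ax; have [xp|px] := leP x p; first by rewrite pasteL ?gid// ax.
    by rewrite (pasteR gh) ?hid// ltW.
  right; exists q, k, e; split => //; first by apply: le_trans pq; exact: ltW.
    move=> x /andP[ax xq]; have [xp|px] := leP x p;
      first by rewrite pasteL ?gid// ax.
    by rewrite (pasteR gh) ?hq// ltW//.
  by split => // x hx; rewrite (pasteR gh) ?hk//; lra.
have [gid|[q [k [e [dq aq gq k0 [e0 gk]]]]]] := IHg _ da ga.
  by apply: gid_p => x /andP[ax _]; exact: gid.
have [pq|qp] := leP p q.
  by apply: gid_p => x hx; apply: gq; lra.
right; exists q, k, (Num.min e (p - q)); split => //.
  by move=> x hx; rewrite pasteL ?gq//; lra.
split; first by rewrite lt_min e0 subr_gt0.
move=> x /andP[qx]; rewrite -lerBlDl le_min => /andP[xe xp].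
by rewrite pasteL ?gk//; lra.
Qed.

Lemma conj_fullVl f g : conj_full f^-1%g g -> conj_full f g.
Proof.
move=> [s1 [s2 [ss1 ss2 full]]]; exists s1, s2; split => // H sH H01 Hf Hg.
by apply: full => //; rewrite conjVg; exact: subgroupV.
Qed.

Lemma conj_fullVr f g : conj_full f g^-1%g -> conj_full f g.
Proof.
move=> [s1 [s2 [ss1 ss2 full]]]; exists s1, s2; split => // H sH H01 Hf Hg.
by apply: full => //; rewrite conjVg; exact: subgroupV.
Qed.

(** Inverting f and g if necessary makes f expand at 0 and g expand just after the first point q
    where it leaves the identity. The cases q = 0 and q > 0 are the two models. *)
Theorem conj_fullP f g (p s : int) : supp 0 1 f -> supp 0 1 g ->
  germ 1 0 f p -> p != 0 -> germ (-1) 1 g s -> s != 0 -> conj_full f g.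
Proof.
move=> sf sg germf p0 germg s0.
have S01 := @supp_subgroup R 0 1.
wlog {p0} : f p sf germf / 0 < p => [IH|p0].
  have [|pn] : 0 < p \/ 0 < - p by lia.
    exact: IH.
  apply: conj_fullVl; apply: IH pn; [exact: subgroupV S01 sf|exact: germV].
have [g0 g1] := supp_end sg.
have not_id : ~ (forall x, 0 <= x <= 1 -> g x = x).
  move=> gid; have : germ (-1) 1 g 0.
    by apply: (@germ_id R _ _ g 1) => // t ht; rewrite gid//; lra.
  move=> /(@germ_inj R (-1) 1 g s 0 _ germg); rewrite oppr_eq0 oner_eq0 =>
    /(_ isT) s00.
  by rewrite s00 eqxx in s0.
have [gid|[q [k [e [dq q0 gq k0 [e0 gk]]]]]] :=
  first_break (plGP g) (@dyadic0 R) g0.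
  by case: not_id => x /andP[x0 _]; exact: gid.
have q1 : q < 1.
  by rewrite ltNge; apply/negP => q1; apply: not_id => x hx; apply: gq; lra.
have {}gq x : x <= q -> g x = x.
  by move=> xq; have [x0|x0] := leP x 0; [apply: sg; left|apply: gq;
    rewrite ltW].
have {gk} gk : germ 1 q g k.
  by exists e => // t ht; rewrite !mul1r gk; [ring|lra].
clear e e0 not_id g0 g1.
wlog {k0} k0 : g s k sg germg s0 gq gk / 0 < k => [IH|].
  have [|kn] : 0 < k \/ 0 < - k by lia.
    by move=> kp; apply: (IH g s k).
  apply: conj_fullVr; apply: (IH g^-1%g (- s) (- k)) => //.
  - exact: subgroupV S01 sg.
  - exact: germV.
  - by lia.
  - by move=> x xq; apply: plG_eqV; exact: gq.
  - exact: germV.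
have [q_gt|q_le] := ltP 0 q.
  by apply: (@conj_full_inner f g q p k s) => //; rewrite q_gt.
have qE : q = 0 by lra.
by rewrite qE in gk; apply: (@conj_full_left R f g p k s).
Qed.

End TwoConjugatesInner.

(** * Back to Thompson's group *)

Section Embedding.
Variable R : realType.
Notation plG := (plG R).
Notation F := (thompsonF R).

Definition emb (f : F) : plG := PlG (thompson_pl2 (thompsonFP f)).

Lemma emb_inj : injective emb.
Proof.
by move=> f g fg; apply: thompsonF_inj => x; exact: (congr1 (fun u : plG =>
  u x) fg).
Qed.

Lemma embM f g : emb (f * g)%g = (emb f * emb g)%g.
Proof. exact: plG_inj. Qed.

Lemma emb1 : emb 1%g = 1%g.
Proof. exact: plG_inj. Qed.

Lemma embV f : emb f^-1%g = (emb f)^-1%g.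
Proof. by apply: (@mulgI _ (emb f)); rewrite -embM !mulgV emb1. Qed.

Lemma embJ f g : emb (f ^ g)%g = (emb f ^ emb g)%g.
Proof. by rewrite !conjgE !embM embV. Qed.

Lemma emb_supp f : supp 0 1 (emb f).
Proof.
move=> x hx; have [_ _ fx _] := thompsonFP f; apply: fx.
by rewrite in_itv /=; apply/negP => /andP[]; lra.
Qed.

Lemma emb_surj (u : plG) : supp 0 1 u -> exists f, emb f = u.
Proof.
move=> su; have tu : thompson_set u.
  apply: pl2_thompson (plGP u) _ => x; rewrite in_itv /= negb_and -!leNgt =>
    /orP hx.
  exact: su.
by exists (exist _ (ap u) (mem_set tu)); apply: plG_inj.
Qed.

Lemma pow2_inj : injective (fun k : int => 2 ^ k : R).
Proof. by move=> k l /(@ieexprIz R 2); apply => //; rewrite gt_eqF ?ltr1n. Qed.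

Lemma germ_ab f : germ 1 0 (emb f) (thompson_ab f).1 /\
  germ (-1) 1 (emb f) (thompson_ab f).2.
Proof.
have [d0 d1] := thompson_abE f; have [f0 f1] := supp_end (emb_supp f).
split.
  have [k [e e0 fk]] := germ0_ex f0.
  suff -> : (thompson_ab f).1 = k by exists e.
  apply: pow2_inj; rewrite -d0; apply: (@right_slope R f _ e e0) =>
    h /andP[h0 he].
  have := fk h; rewrite !add0r !mul1r => fh; rewrite -[f h]/(emb f h) fh ?(ltW
    h0) ?ltW//.
  by rewrite [f 0]f0 add0r.
have [k [e e0 fk]] := germ1_ex f1.
suff -> : (thompson_ab f).2 = k by exists e.
apply: pow2_inj; rewrite -d1; apply: (@left_slope R f _ e e0) => h /andP[h0 he].
have := fk (- h); rewrite mulNr mul1r opprK => fh.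
have he' : 0 <= - h <= e by clear -h0 he; lra.
apply: etrans (fh he') _; rewrite [f 1]f1.
by clear; ring.
Qed.

Lemma ab_germ f k l : germ 1 0 (emb f) k -> germ (-1) 1 (emb f) l ->
  thompson_ab f = (k, l).
Proof.
have [g0 g1] := germ_ab f; move=> f0 f1; rewrite [thompson_ab
  f]surjective_pairing.
by rewrite (germ_inj _ g0 f0) ?oner_eq0// (germ_inj _ g1 f1).
Qed.

Lemma abM f g : thompson_ab (f * g : F)%g = thompson_ab f + thompson_ab g.
Proof.
have [[f0 f1] [g0 g1]] := (germ_ab f, germ_ab g).
by apply: ab_germ; rewrite embM; exact: germM.
Qed.

Lemma abV f : thompson_ab (f^-1 : F)%g = - thompson_ab f.
Proof.
by have [f0 f1] := germ_ab f; apply: ab_germ; rewrite embV; exact: germV.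
Qed.

Lemma abJ f g : thompson_ab (f ^ g : F)%g = thompson_ab f.
Proof. by rewrite conjgE !abM abV addrC -addrA addrN addr0. Qed.

Lemma ab_eq_inner f g : thompson_ab f = thompson_ab g ->
  inner (emb (f^-1 * g)%g).
Proof.
move=> fg; have [h0 h1] := germ_ab (f^-1 * g : F)%g.
move: h0 h1; rewrite abM abV fg addNr => h0 h1; split => //.
exact: emb_supp.
Qed.

End Embedding.

(** * Generation in Z^2 and in F *)

Lemma generatesP (G : groupType) (S : set G) : generates S <->
  forall H : set G, H 1%g -> (forall x y, H x -> H y -> H (x / y)%g) ->
    S `<=` H -> forall x, H x.
Proof.
split=> [gS H H1 HV SH x|gS].
  have : [set: G] x by []; rewrite -gS; apply; split => //.
  split; first by rewrite inE.
  by move=> y z; rewrite !inE; exact: HV.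
apply/seteqP; split => // x _ H [[H1 HV] SH]; apply: gS SH _.
  by rewrite inE in H1.
by move=> y z Hy Hz; have := HV y z; rewrite !inE; apply.
Qed.

(** A form (a, b) vanishing on both generators vanishes on Z^2, hence at (a, b) itself, so a = b =
    0. A zero determinant makes (s, -r) and (q, -p) such forms; all entries are then 0 and the form
    (1, 0) gives a contradiction. *)
Lemma generating_det (p q r s : int) :
  generates (G := Algebra.to_multiplicative (int * int)%type) [set (p, q); (r,
    s)] ->
  p * s <> q * r.
Proof.
move=> /generatesP gen det.
have line (a b : int) : a * p + b * q = 0 -> a * r + b * s = 0 ->
  a = 0 /\ b = 0.
  move=> ab1 ab2.
  have /(_ (a, b)) : forall x : int * int, a * x.1 + b * x.2 = 0.
    apply: (gen (fun x : int * int => a * x.1 + b * x.2 = 0)).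
    - by rewrite /= !mulr0.
    - move=> x y hx hy; have -> : a * (x.1 - y.1) + b * (x.2 - y.2) = 
        (a * x.1 + b * x.2) - (a * y.1 + b * y.2) by ring.
      by rewrite hx hy subr0.
    - by move=> _ [->|->].
  rewrite /= => ab0; have : a * a = 0 /\ b * b = 0 by nia.
  by case=> /eqP; rewrite mulf_eq0 orbb => /eqP -> /eqP;
    rewrite mulf_eq0 orbb => /eqP.
have [|| s0 r0] := line s (- r); [lia|lia|].
have [|| q0 p0] := line q (- p); [lia|lia|].
by have [||] := line 1 0; lia.
Qed.

Theorem corollary6 (R : realType) (f g : thompsonF R)
  (Hfg : generates (G := Algebra.to_multiplicative (int * int)%type)
           [set thompson_ab f; thompson_ab g]%classic) :
  exists sigma : thompsonF R, generates [set f; (g ^ sigma)%g]%classic.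
Proof.
have [f0 f1] := germ_ab f; have [g0 g1] := germ_ab g.
have sf := emb_supp f; have sg := emb_supp g.
have S01 := @supp_subgroup R 0 1.
have [s1 [s2 [ss1 ss2 full]]] : conj_full (emb f) (emb g).
  have det : (thompson_ab f).1 * (thompson_ab g).2 <> (thompson_ab f).2 *
    (thompson_ab g).1.
    by apply: generating_det; rewrite -!surjective_pairing.
  (* One of the two products in the determinant is nonzero; the second case exchanges f and g. *)
  have [/andP[p0 s0]|/andP[q0 r0]] :
      ((thompson_ab f).1 != 0) && ((thompson_ab g).2 != 0) \/
      ((thompson_ab f).2 != 0) && ((thompson_ab g).1 != 0) by nia.
    exact: conj_fullP f0 p0 g1 s0.
  have [s1 [s2 [ss1 ss2 full]]] := conj_fullP sg sf g0 r0 f1 q0.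
  by exists s2, s1; split => // H sH H01 Hf Hg; exact: full.
have ss : supp 0 1 (s2 * s1^-1)%g by exact: (proj2 S01).
have [sigma sigmaE] := emb_surj ss.
exists sigma; apply/generatesP => H H1 HV HS.
have HV' y : H y -> H y^-1%g by move=> Hy; rewrite -[y^-1%g]mul1g; exact: HV.
have HM y z : H y -> H z -> H (y * z)%g.
  by move=> Hy Hz; rewrite -[z]invgK; apply: HV => //; exact: HV'.
have Hf : H f by apply: HS; left.
have Hg : H (g ^ sigma)%g by apply: HS; right.
(* The conjugate of H by s1: it contains f^s1 and, as sigma = s2 s1^-1, also g^s2. *)
pose HP u := exists2 y, H y & emb y = (u ^ s1^-1)%g.
have sHP : is_subgroup HP.
  split; first by exists 1%g => //; rewrite conj1g emb1.
  move=> u v [y Hy yE] [z Hz zE]; exists (y / z)%g; first exact: HV.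
  by rewrite embM embV conjMg conjVg yE zE.
have HP_inner (k : plG R) : inner k -> HP k.
  apply: (full HP sHP).
  - move=> u [y _ yE]; rewrite -[u](conjgKV s1) -yE.
    by apply: subgroupJ S01 (emb_supp y) ss1.
  - by exists f => //; rewrite conjgK.
  - by exists (g ^ sigma)%g => //; rewrite embJ sigmaE conjgM.
(* Inner elements are stable under conjugation by s1, so the conclusion on HP passes back to H. *)
have H_inner y : inner (emb y) -> H y.
  move=> [sy y0 y1]; have [t0 t1] := supp_end ss1.
  have [l0 hl0] := germ0_ex t0; have [l1 hl1] := germ1_ex t1.
  have [|z Hz] := HP_inner (emb y ^ s1)%g.
    split; [exact: subgroupJ S01 sy ss1|exact: conj_germ hl0|exact: conj_germ
      hl1].
  by rewrite conjgK => /emb_inj <-.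
have onto : forall z : int * int, exists2 y, H y & thompson_ab y = z.
  apply: (proj1 (generatesP _) Hfg (fun z => exists2 y,
    H y & thompson_ab y = z)).
  - by exists 1%g => //; rewrite -(mulgV f) abM abV addrN.
  - move=> _ _ [y Hy <-] [z Hz <-]; exists (y / z)%g; first exact: HV.
    by rewrite abM abV.
  - by move=> _ [->|->]; [exists f|exists (g ^ sigma)%g => //; rewrite abJ].
(* Correct [k] by an element of H with the same image under pi; the quotient is inner. *)
move=> k; have [y Hy yk] := onto (thompson_ab k).
rewrite -[k](mulVKg y); apply: HM => //; apply: H_inner.
exact: ab_eq_inner.
Qed.
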